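(* Let $X$ be a compact subset of a real Banach space $\mathfrak{B}$ with thickness exponent $\tau(X)=\tau(X,\mathfrak{B})$ and box-counting dimension $d_B(X)$. Then for any integer $k>2d_B(X)$ and any given $\theta$ with $$0<\theta<\frac{k-2d_B(X)}{k\,(1+d_B(X))\left(1+\frac{\tau(X)}{2}\right)},$$ there exist a linear map $L:\mathfrak{B}\to\mathbb{R}^k$ and a constant $C_L>0$ such that $$\|x-y\|\le C_L\,|Lx-Ly|^{\theta}\qquad\text{for all }x,y\in X.$$ In particular, $L$ is bijective from $X$ onto $L(X)$ with a Hölder continuous inverse.
   Context: $|\cdot|$ is the Euclidean norm on $\mathbb{R}^k$. Box-counting dimension: $d_B(X)=\limsup_{\epsilon\to0}\frac{\log N(X,\epsilon)}{-\log\epsilon}$, where $N(X,\epsilon)$ is the minimum number of balls of radius $\epsilon$ with centres in $X$ required to cover $X$. Thickness exponent: for $X\subset\mathfrak{B}$, $\tau(X,\mathfrak{B})=\limsup_{\epsilon\to0}\frac{\log d(X,\epsilon)}{-\log\epsilon}$, where $d(X,\epsilon)$ is the smallest dimension of those linear subspaces $V$ of $\mathfrak{B}$ that satisfy $\mathrm{dist}_{\mathfrak{B}}(x,V)\le\epsilon$ for all $x\in X$ (and $d(X,\epsilon)=\infty$ if no such finite-dimensional subspace exists). *)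

(* Defs.v *)
From HB Require Import structures.
From mathcomp Require Import all_boot all_order all_algebra.
From mathcomp Require Import all_classical all_reals all_analysis.

Set Implicit Arguments.
Unset Strict Implicit.
Unset Printing Implicit Defensive.

Import Order.TTheory GRing.Theory Num.Theory.
Import numFieldNormedType.Exports.

Local Open Scope classical_set_scope.
Local Open Scope ring_scope.

(* The library norm on row vectors is the sup norm, so the Euclidean norm is
   introduced separately. *)
Definition eucl_norm (R : realType) (k : nat) (v : 'rV[R]_k) : R :=
  Num.sqrt (\sum_(i < k) v ord0 i ^+ 2).

(* Values in \bar R: the infimum is +oo when no finite cover exists. *)
Definition covering_number (R : realType) (B : normedModType R) (X : set B)
    (e : R) : \bar R :=
  ereal_inf [set (n%:R)%:E | n in [set n : nat |
    exists2 c : 'I_n -> B, (forall i, X (c i)) &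
      X `<=` \bigcup_(i in [set: 'I_n]) ball (c i) e]].

(* [lne 0 = -oo], hence [box_dim set0 = -oo]. *)
Definition box_dim (R : realType) (B : normedModType R) (X : set B) : \bar R :=
  limf_esup (fun e : R => (lne (covering_number X e) / (- ln e)%:E)%E) 0^'+.

Definition lin_indep (R : realType) (B : lmodType R) (n : nat)
    (b : 'I_n -> B) : Prop :=
  forall a : 'I_n -> R, \sum_(i < n) a i *: b i = 0 -> forall i, a i = 0.

Definition subspace_of_dim (R : realType) (B : lmodType R) (n : nat)
    (V : set B) : Prop :=
  exists2 b : 'I_n -> B, lin_indep b &
    V = range (fun a : 'I_n -> R => \sum_(i < n) a i *: b i).

Definition dist_to (R : realType) (B : normedModType R) (x : B) (V : set B)
    : R :=
  inf [set `|x - v| | v in V].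

Definition approx_dim (R : realType) (B : normedModType R) (X : set B)
    (e : R) : \bar R :=
  ereal_inf [set (n%:R)%:E | n in [set n : nat |
    exists2 V : set B, subspace_of_dim n V &
      forall x, X x -> dist_to x V <= e]].

(* If X is contained in {0} then [approx_dim X e = 0] for all e > 0 and the
   thickness exponent is -oo. *)
Definition thickness_exponent (R : realType) (B : normedModType R)
    (X : set B) : \bar R :=
  limf_esup (fun e : R => (lne (approx_dim X e) / (- ln e)%:E)%E) 0^'+.

(* Hölder continuity on A with respect to the Euclidean norm on the source. *)
Definition holder_on (R : realType) (B : normedModType R) (k : nat)
    (theta : R) (A : set 'rV[R]_k) (g : 'rV[R]_k -> B) : Prop :=
  exists C : R, forall u v, A u -> A v ->
    `|g u - g v| <= C * eucl_norm (u - v) `^ theta.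

(* Main.v *)
Require Import Defs.
From HB Require Import structures.
From mathcomp Require Import all_boot all_order all_algebra.
From mathcomp Require Import all_classical all_reals all_analysis.
From mathcomp Require Import ring lra.

Set Implicit Arguments.
Unset Strict Implicit.
Unset Printing Implicit Defensive.

Import Order.TTheory GRing.Theory Num.Theory.
Import numFieldNormedType.Exports.

Local Open Scope classical_set_scope.
Local Open Scope ring_scope.

(* At scale e, cover X by n balls of radius e/8 and collect norming functionals
   of the n^2 differences of centres into F : B -> R^(n^2); then
   |F z| >= e/2 for every z = x - y with x, y in X and |z| >= e, while
   |F| <= n.  If V is an m-dimensional space approximating X within e/(32n), the
   orthogonal projection of F z onto F V is still of size e, and a Gaussian
   vector of F V normalised by n * sqrt m gives a random functional of norm O(1)
   for which |z| >= e is mapped below s with probability at most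
   O(s * n * sqrt m / e).  With n ~ e^-d and m ~ (e/n)^-tau this is
   s / e^((1+d)(1+tau/2)).  Summing k independent copies over dyadic scales and
   taking a union bound over the pairs of an s-net of X, with s = e^(1/theta),
   yields |L z| >= s at every scale exactly when theta is below the stated bound.

   No infinite product measure is needed.  For finitely many scales the Gaussian
   coefficients are fixed one at a time so that a conditional expectation never
   increases, the event |L z| < s being replaced by exp(-|L z|^2 / (2 s^2)), whose
   Gaussian averages are explicit and of the same form.  An ultrafilter limit then
   handles all scales at once. *)

(** * Norming functionals *)

Section NormingFunctional.
Context {R : realType} {B : normedModType R}.

(** Graphs of partial linear functionals bounded by the norm. Extension is then inclusion, as Zorn's
    lemma wants; single-valuedness is a consequence of the bound. *)
Let dominated_graph (G : set (B * R)) :=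
  [/\ forall (a : R) p q, G p -> G q -> G (a *: p.1 + q.1, a * p.2 + q.2),
      G (0, 0) & forall p, G p -> p.2 <= `|p.1|].

Let dominated_graph_scale G (a : R) p : dominated_graph G -> G p ->
  G (a *: p.1, a * p.2).
Proof. by move=> [Glin G0 _] Gp; have := Glin a _ _ Gp G0; rewrite !addr0. Qed.

(** Both [(0, r - s)] and [(0, s - r)] lie in [G], and the bound by the norm of 0 leaves only
    [r = s]. *)
Let dominated_graph_fun G x r s : dominated_graph G -> G (x, r) -> G (x, s) ->
  r = s.
Proof.
move=> [Glin G0 Gle] Gr Gs.
have := Gle _ (Glin (-1) _ _ Gr Gs); have := Gle _ (Glin (-1) _ _ Gs Gr).
rewrite /= !scaleN1r addNr normr0 !mulN1r => h1 h2.
by apply/eqP; rewrite eq_le; apply/andP; split; lra.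
Qed.

(** The one-dimensional Hahn-Banach step: the value at [x0] must lie between all [p.2 - |p.1 - x0|]
    and all [|q.1 + x0| - q.2], and the bound at [p + q] keeps the former below the latter. Scaling
    by [|t|] reduces a general multiple of [x0] to [x0] or [- x0]. *)
Let dominated_graph_extend G x0 : dominated_graph G ->
  exists r : R, dominated_graph
    [set q | exists p t, G p /\ q = (p.1 + t *: x0, p.2 + t * r)].
Proof.
move=> GG; have [Glin G0 Gle] := GG.
pose S := [set p.2 - `|p.1 - x0| | p in G].
have Sub (q : B * R) : G q -> ubound S (`|q.1 + x0| - q.2).
  move=> Gq _ [p Gp <-]; have := Gle _ (Glin 1 _ _ Gp Gq).
  rewrite /= scale1r mul1r => pq.
  have := ler_normD (p.1 - x0) (q.1 + x0).
  have -> : p.1 - x0 + (q.1 + x0) = p.1 + q.1 by rewrite addrACA addNr addr0.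
  by lra.
have supS : has_sup S.
  by split; [exists (0 - `|0 - x0|), (0, 0) | exists (`|0 + x0| - 0); exact: (Sub (0, 0))].
pose r := sup S.
have ler (p : B * R) : G p -> p.2 - r <= `|p.1 - x0|.
  by move=> Gp; rewrite lerBlDl -lerBlDr; apply: sup_upper_bound => //; exists p.
have rle (q : B * R) : G q -> q.2 + r <= `|q.1 + x0|.
  by move=> Gq; rewrite addrC -lerBrDr; apply: ge_sup (Sub _ Gq); case: supS.
exists r; split.
- move=> a _ _ [p [t [Gp ->]]] [q [u [Gq ->]]] /=.
  exists (a *: p.1 + q.1, a * p.2 + q.2), (a * t + u); split; first exact: Glin.
  congr pair => /=; last by ring.
  by rewrite scalerDr scalerA scalerDl addrACA.
- exists (0, 0), 0; split; first exact: G0.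
  by rewrite /= scale0r mul0r !addr0.
- move=> _ [p [t [Gp ->]]] /=; have [t0|t0|->] := ltgtP t 0.
  + have := ler _ (dominated_graph_scale (- t)^-1 GG Gp) => /=.
    have Nt0 : 0 < - t by rewrite oppr_gt0.
    rewrite -(ler_pM2l Nt0) mulrBr mulrA divff ?gt_eqF// mul1r.
    rewrite -{2}(gtr0_norm Nt0) -normrZ scalerBr scalerA divff ?gt_eqF// scale1r.
    by rewrite mulNr opprK scaleNr opprK.
  + have := rle _ (dominated_graph_scale t^-1 GG Gp) => /=.
    rewrite -(ler_pM2l t0) mulrDr mulrA divff ?gt_eqF// mul1r.
    by rewrite -{2}(gtr0_norm t0) -normrZ scalerDr scalerA divff ?gt_eqF// scale1r.
  + by rewrite scale0r mul0r !addr0; exact: Gle.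
Qed.

Lemma norming_functional (c : B) :
  exists2 f : {scalar B}, (forall x, `|f x| <= `|x|) & f c = `|c|.
Proof.
pose L := range (fun t : R => (t *: c, t * `|c|)).
have LL : dominated_graph L.
  split.
  - move=> a _ _ [t _ <-] [u _ <-]; exists (a * t + u) => //=.
    by rewrite scalerDl scalerA mulrDl mulrA.
  - by exists 0 => //; rewrite scale0r mul0r.
  - move=> _ [t _ <-] /=; rewrite normrZ ler_wpM2r//; exact: ler_norm.
(* Zorn's lemma runs over the [G] whose union with [L] is dominated, rather than over the [G]
   containing [L], so that the empty union of the empty chain is admissible. *)
have [F Fsub Ftot|A [AL Amax]] :=
  @Zorn_bigcup _ [set G | dominated_graph (G `|` L)].
  have FL p : (\bigcup_(X in F) X `|` L) p -> L p \/ exists2 X, F X & (X `|` L) p.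
    by case=> [[X FX Xp]|Lp]; [right; exists X => //; left|left].
  have FU X : F X -> X `|` L `<=` \bigcup_(X in F) X `|` L.
    by move=> FX; apply: setSU; exact: bigcup_sup.
  split.
  - move=> a p q /FL[Lp|[X FX Xp]] /FL[Lq|[Y FY Yq]].
    + by right; have [Llin _ _] := LL; exact: Llin.
    + by apply: (FU _ FY); have [Ylin _ _] := Fsub _ FY; apply: Ylin => //; right.
    + by apply: (FU _ FX); have [Xlin _ _] := Fsub _ FX; apply: Xlin => //; right.
    + have [XY|YX] := Ftot _ _ FX FY.
        apply: (FU _ FY); have [Ylin _ _] := Fsub _ FY; apply: Ylin => //.
        by case: Xp => [/XY|]; [left|right].
      apply: (FU _ FX); have [Xlin _ _] := Fsub _ FX; apply: Xlin => //.
      by case: Yq => [/YX|]; [left|right].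
  - by right; have [_ ? _] := LL.
  - move=> p /FL[Lp|[X FX Xp]]; first by have [_ _] := LL; exact.
    by have [_ _] := Fsub _ FX; exact.
have Gmax G : dominated_graph G -> A `|` L `<=` G -> G `<=` A `|` L.
  move=> GG ALG; apply: contrapT => GA; apply: (Amax G).
    split; first by move=> p Ap; apply: ALG; left.
    by apply: contra_not GA => GA p Gp; left; exact: GA.
  rewrite /= (_ : G `|` L = G)//; apply/setUidPl => p Lp.
  by apply: ALG; right.
have Atotal x : exists r, (A `|` L) (x, r).
  have [r Gr] := dominated_graph_extend x AL; exists r.
  apply: (Gmax _ Gr); last first.
    by exists (0, 0), 1; rewrite scale1r mul1r !add0r; split=> //; case: AL.
  by move=> p Ap; exists p, 0; rewrite scale0r mul0r !addr0; split=> //; case: p Ap.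
have [f Af] := choice Atotal.
have [Alin _ Ale] := AL.
have flin : scalar f.
  move=> a x y; apply: (dominated_graph_fun AL (Af _)).
  exact: (Alin a (x, f x) (y, f y)).
pose fL := HB.pack_for {scalar B} f (GRing.isLinear.Build R B R *%R f flin).
exists fL => [x|]; last first.
  apply: (dominated_graph_fun AL (Af _)); right; exists 1 => //.
  by rewrite scale1r mul1r.
rewrite ler_norml (Ale _ (Af x)) andbT lerNl.
have := Ale _ (Af (- x)); rewrite /= normrN; congr (_ <= _).
by have := linearN fL x.
Qed.

End NormingFunctional.

(** * Derandomised Gaussian averaging *)

(** Integration over [t] turns the left side into the sum of the [c i] and the right side into [C],
    so the reverse strict inequality cannot hold everywhere. This existence of a good [t] replaces a
    random choice. *)
Lemma normal_mixture_le (R : realType) (I : Type) (r : seq I) (c m s : I -> R)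
    (C : R) : \sum_(i <- r) c i <= C ->
  exists t, \sum_(i <- r) c i * normal_pdf (m i) (s i) t <= C * normal_pdf 0 1 t.
Proof.
move=> cC; apply: contrapT => /forallNP noT.
pose f (t : R) := \sum_(i <- r) c i * normal_pdf (m i) (s i) t - C * normal_pdf 0 1 t.
have f_gt0 t : 0 < f t by rewrite subr_gt0 ltNge; apply/negP/noT.
pose fE t := (\sum_(i <- r) (c i)%:E * (normal_pdf (m i) (s i) t)%:E)%E.
have fEE : (EFin \o f) = (fun t => fE t - C%:E * (normal_pdf 0 1 t)%:E)%E.
  by apply/funext => t; rewrite /= EFinB EFinM -sumEFin.
have int1 i : lebesgue_measure.-integrable setT
    (fun t => (c i)%:E * (normal_pdf (m i) (s i) t)%:E)%E.
  by apply: integrableZl => //; exact: integrable_normal_pdf.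
have intfE : lebesgue_measure.-integrable setT fE by apply: integrable_sum.
have int2 : lebesgue_measure.-integrable setT (fun t => C%:E * (normal_pdf 0 1 t)%:E)%E.
  by apply: integrableZl => //; exact: integrable_normal_pdf.
have intf : lebesgue_measure.-integrable setT (EFin \o f) by rewrite fEE; exact: integrableB.
have If : (\int[lebesgue_measure]_t (EFin \o f) t <= 0)%E.
  rewrite fEE integralB// /fE integral_sum//.
  rewrite integralZl//; last exact: integrable_normal_pdf.
  rewrite integral_normal_pdf mule1 sube_le0.
  under eq_bigr => i _.
    rewrite integralZl//; last exact: integrable_normal_pdf.
    by rewrite integral_normal_pdf mule1; over.
  by rewrite sumEFin lee_fin.
have absf0 : (\int[lebesgue_measure]_t `|(EFin \o f) t| = 0)%E.
  apply/eqP; rewrite eq_le integral_ge0// andbT.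
  under eq_integral => t _ do rewrite /= gtr0_norm//.
  exact: If.
move/ae_eq_integral_abs : absf0 => /(_ measurableT (measurable_int _ intf)).
move=> [N [mN N0 subN]].
(* [f] vanishes outside the null set [N] but is positive everywhere, so [N] is the whole line,
   against the positive length of [[0, 1]]. *)
have NT : N = setT.
  apply/seteqP; split=> // t _; apply: subN => /= /(_ Logic.I) /eqP.
  by rewrite eqe gt_eqF.
have : (lebesgue_measure (`[0%R, 1%R] : set R) <= lebesgue_measure N)%E.
  by apply: le_measure; rewrite ?inE//= NT.
by rewrite N0 lebesgue_measure_itv /= lte01 oppr0 adde0 leNgt lte01.
Qed.

(** An unnormalised centred Gaussian; [S] is the variance, not the standard deviation, because
    variances add under averaging. *)
Definition gbump {R : realType} (S x : R) := expR (- (x ^+ 2 / (2 * S))).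

Lemma normal_pdf01_gt0 (R : realType) (t : R) : 0 < normal_pdf 0 1 t.
Proof.
by rewrite normal_pdfE ?oner_eq0//; apply: mulr_gt0; rewrite ?expR_gt0 ?normal_peak_gt0 ?oner_neq0.
Qed.

Lemma normal_peak_div (R : realType) (s : R) : 0 < s ->
  normal_peak 1 = s * normal_peak s.
Proof.
move=> s0; rewrite /normal_peak expr1n mul1r -mulrnAr sqrtrM ?sqr_ge0//.
by rewrite sqrtr_sqr gtr0_norm// invfM mulrA divff ?gt_eqF// mul1r.
Qed.

(** Completing the square in [t]. Averaging a bump over a standard Gaussian [t] therefore raises its
    variance from [S] to [S + v ^+ 2], at the gain of the square-root factor. *)
Lemma gbump_normal_pdf (R : realType) (S b v t : R) : 0 < S ->
  gbump S (b + v * t) * normal_pdf 0 1 t =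
  Num.sqrt (S / (S + v ^+ 2)) * gbump (S + v ^+ 2) b *
  normal_pdf (- (b * v) / (S + v ^+ 2)) (Num.sqrt (S / (S + v ^+ 2))) t.
Proof.
move=> S0; have T0 : 0 < S + v ^+ 2 by rewrite ltr_wpDr ?sqr_ge0.
have sg0 : 0 < Num.sqrt (S / (S + v ^+ 2)) by rewrite sqrtr_gt0 divr_gt0.
rewrite !normal_pdfE ?oner_eq0 ?gt_eqF// (normal_peak_div sg0).
rewrite /normal_fun sqr_sqrtr ?divr_ge0 ?ltW//.
have key : gbump S (b + v * t) * expR (- (t - 0) ^+ 2 / (1 ^+ 2 *+ 2)) =
    gbump (S + v ^+ 2) b *
    expR (- (t - - (b * v) / (S + v ^+ 2)) ^+ 2 / ((S / (S + v ^+ 2)) *+ 2)).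
  by rewrite /gbump -!expRD; congr expR; field; rewrite !gt_eqF.
by rewrite mulrCA key; ring.
Qed.

(** As [t^2/4 - t^2/2 = -t^2/4], the penalty [expR (t ^+ 2 / 4)] on large coefficients has Gaussian
    average [Num.sqrt 2]. *)
Lemma expR_sq4_normal_pdf (R : realType) (t : R) :
  expR (t ^+ 2 / 4) * normal_pdf 0 1 t =
  Num.sqrt 2 * normal_pdf 0 (Num.sqrt 2) t.
Proof.
have s0 : 0 < Num.sqrt (2 : R) by rewrite sqrtr_gt0.
rewrite !normal_pdfE ?oner_eq0 ?gt_eqF// (normal_peak_div s0).
rewrite /normal_fun sqr_sqrtr//.
have key : expR (t ^+ 2 / 4) * expR (- (t - 0) ^+ 2 / (1 ^+ 2 *+ 2)) =
    expR (- (t - 0) ^+ 2 / (2 *+ 2)).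
  by rewrite -!expRD; congr expR; field.
by rewrite mulrCA key mulrA.
Qed.

Lemma gbump0 (R : realType) (S : R) : gbump S 0 = 1.
Proof. by rewrite /gbump expr0n/= mul0r oppr0 expR0. Qed.

Section GaussianAveraging.
Context {R : realType} {I : Type} (P : seq I) (S : I -> R).
Hypothesis S_gt0 : forall p, 0 < S p.

Lemma gbump_step (w v b T : I -> R) (beta : R) : (forall p, 0 < T p) ->
  exists t, \sum_(p <- P) w p * gbump (T p) (b p + v p * t)
              + beta * expR (t ^+ 2 / 4) <=
    \sum_(p <- P) w p * (Num.sqrt (T p / (T p + v p ^+ 2))
                        * gbump (T p + v p ^+ 2) (b p)) + beta * Num.sqrt 2.
Proof.
move=> T0.
(* The index [None] carries the penalty and [Some p] the bumps, so that one [t] controls both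
   sums. *)
pose c i := if i is Some p then w p * (Num.sqrt (T p / (T p + v p ^+ 2))
                        * gbump (T p + v p ^+ 2) (b p)) else beta * Num.sqrt 2.
pose m i := if i is Some p then - (b p * v p) / (T p + v p ^+ 2) else 0.
pose s i := if i is Some p then Num.sqrt (T p / (T p + v p ^+ 2)) else Num.sqrt 2.
have [t] := @normal_mixture_le R _ (None :: map Some P) c m s _ (lexx _).
rewrite !big_cons !big_map /= => ht; exists t.
rewrite -(ler_pM2r (normal_pdf01_gt0 t)) [in leRHS]addrC; apply: le_trans ht.
rewrite le_eqVlt; apply/orP; left; apply/eqP.
rewrite mulrDl addrC; congr (_ + _).
  by rewrite -[LHS]mulrA expR_sq4_normal_pdf mulrA.
by rewrite mulr_suml; apply: eq_bigr => p _; rewrite -[LHS]mulrA gbump_normal_pdf// !mulrA.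
Qed.

(** The right side is the average of the left over independent standard Gaussians [g j]. The
    coefficients are fixed one after another; the shift [b] records those already fixed. *)
Lemma gbump_vector (J : eqType) (s : seq J) (a : I -> J -> R) (w b : I -> R)
    (beta : J -> R) : uniq s ->
  exists g : J -> R,
    \sum_(p <- P) w p * gbump (S p) (b p + \sum_(j <- s) a p j * g j)
      + \sum_(j <- s) beta j * expR (g j ^+ 2 / 4) <=
    \sum_(p <- P) w p * (Num.sqrt (S p / (S p + \sum_(j <- s) a p j ^+ 2))
        * gbump (S p + \sum_(j <- s) a p j ^+ 2) (b p))
      + Num.sqrt 2 * \sum_(j <- s) beta j.
Proof.
elim: s b => [b _|j0 s IH b /= /andP[j0s us]].
  exists (fun=> 0); rewrite !big_nil mulr0 lerD2r le_eqVlt; apply/orP; left.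
  apply/eqP/eq_bigr => p _; rewrite !big_nil !addr0 divff ?gt_eqF//.
  by rewrite sqrtr1 mul1r.
pose A p := \sum_(j <- s) a p j ^+ 2.
have A0 p : 0 <= A p by apply: sumr_ge0 => j _; exact: sqr_ge0.
have SA0 p : 0 < S p + A p by rewrite ltr_wpDr.
(* The head is chosen while the tail is still averaged, hence the variance [S p + A p]; the tail is
   then chosen with the head inside the shift. The two square-root factors telescope. *)
have [t ht] := gbump_step (fun p => w p * Num.sqrt (S p / (S p + A p)))
  (fun p => a p j0) b (beta j0) SA0.
have [g hg] := IH (fun p => b p + a p j0 * t) us.
exists (fun j => if j == j0 then t else g j).
have sumE (F G : J -> R) : {in s, F =1 G} ->
    \sum_(j <- s) F j = \sum_(j <- s) G j by exact: eq_big_seq.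
have neq j : j \in s -> (j == j0) = false.
  by move=> js; apply: contraNF j0s => /eqP <-.
rewrite !big_cons eqxx (sumE _ (fun j => beta j * expR (g j ^+ 2 / 4))); last first.
  by move=> j /neq ->.
under eq_bigr => p _.
  rewrite big_cons eqxx (sumE _ (fun j => a p j * g j)); last by move=> j /neq ->.
  rewrite addrA; over.
rewrite addrCA; apply: le_trans (lerD (lexx _) hg) _.
rewrite addrA mulrDr.
rewrite [Num.sqrt 2 * beta j0]mulrC -/(A _) addrA.
rewrite lerD2r [leLHS]addrC; under [X in X + _ <= _]eq_bigr do rewrite mulrA.
apply: (le_trans ht).
rewrite lerD2r le_eqVlt; apply/orP; left; apply/eqP/eq_bigr => p _.
rewrite big_cons [_ ^+ 2 + _]addrC addrA -[LHS]mulrA; congr (_ * _).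
rewrite mulrA; congr (_ * _).
rewrite -sqrtrM ?divr_ge0 ?ltW//; congr Num.sqrt.
by rewrite mulrA divfK// gt_eqF.
Qed.

(** The [k] rows are fixed in turn: rows still to come enter the weight through their average, rows
    already fixed through the value of their bump. This is why arbitrary weights [w] are allowed. *)
Lemma gbump_matrix (J : eqType) (s : seq J) (a : I -> J -> R) (w : I -> R)
    (beta : J -> R) (k : nat) : uniq s ->
  exists G : nat -> J -> R,
    \sum_(p <- P) w p * \prod_(c < k) gbump (S p) (\sum_(j <- s) a p j * G c j)
      + \sum_(c < k) \sum_(j <- s) beta j * expR (G c j ^+ 2 / 4) <=
    \sum_(p <- P) w p * Num.sqrt (S p / (S p + \sum_(j <- s) a p j ^+ 2)) ^+ k
      + k%:R * (Num.sqrt 2 * \sum_(j <- s) beta j).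
Proof.
move=> us; elim: k w => [|k IH] w.
  exists (fun=> fun=> 0); rewrite big_ord0 mul0r lerD2r.
  by apply: ler_sum => p _; rewrite big_ord0 expr0.
have [g hg] := gbump_vector a
  (fun p => w p * Num.sqrt (S p / (S p + \sum_(j <- s) a p j ^+ 2)) ^+ k)
  (fun=> 0) beta us.
have [G hG] := IH (fun p => w p * gbump (S p) (\sum_(j <- s) a p j * g j)).
exists (fun c => if c is c'.+1 then G c' else g).
rewrite big_ord_recl /=; under eq_bigr do rewrite big_ord_recl /= mulrA.
pose rho p := Num.sqrt (S p / (S p + \sum_(j <- s) a p j ^+ 2)).
have e1 p : w p * rho p ^+ k * gbump (S p) (0 + \sum_(j <- s) a p j * g j) =
    w p * gbump (S p) (\sum_(j <- s) a p j * g j) * rho p ^+ k.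
  by rewrite add0r mulrAC.
have e2 p : w p * rho p ^+ k *
    (rho p * gbump (S p + \sum_(j <- s) a p j ^+ 2) 0) = w p * rho p ^+ k.+1.
  by rewrite gbump0 mulr1 -mulrA -exprSr.
rewrite (eq_bigr _ (fun p _ => e1 p)) (eq_bigr _ (fun p _ => e2 p)) in hg.
move: hg hG; rewrite /rho => hg hG.
by rewrite -[k.+1]add1n natrD mulrDl mul1r; lra.
Qed.

End GaussianAveraging.

(** * Box-counting dimension and thickness *)

Section GrowthExponent.
Context {R : realType}.
Implicit Types (S : R -> set nat) (e s : R).

(** The common shape of both exponents: [S e] is the set of admissible cardinalities, or of
    admissible dimensions, at scale [e]. *)
Definition growth_ratio S e : \bar R :=
  (lne (ereal_inf [set (n%:R)%:E | n in S e]) / (- ln e)%:E)%E.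

Definition growth S : \bar R := limf_esup (growth_ratio S) 0^'+.

Lemma lne_lt_fin (y : \bar R) s : (lne y < s%:E)%E = (y < (expR s)%:E)%E.
Proof.
case: y => [r||] //=; last by rewrite !ltNyr.
have [r0|r0] := leP r 0; first by rewrite ltNyr lte_fin (le_lt_trans r0) ?expR_gt0.
by rewrite !lte_fin -ltr_expR lnK.
Qed.

Lemma growth_ratio_lt S e s : 0 < e < 1 ->
  (growth_ratio S e < s%:E)%E <-> exists2 n, S e n & n%:R < e `^ (- s).
Proof.
move=> /andP[e0 e1]; have le0 : 0 < - ln e by rewrite oppr_gt0 ln_lt0// e0.
rewrite /growth_ratio inver gt_eqF// lte_pdivrMr// -EFinM lne_lt_fin.
have -> : expR (s * - ln e) = e `^ (- s) by rewrite /powR gt_eqF// mulNr mulrN.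
split=> [/ereal_inf_lt[_ [n Sn <-]]|[n Sn ne]].
  by rewrite lte_fin => ne; exists n.
by apply: (@le_lt_trans _ _ (n%:R)%:E); [apply: ereal_inf_lbound; exists n|].
Qed.

Lemma near0_lt1 : \forall e \near (0 : R)^'+, 0 < e < 1.
Proof.
near=> e; apply/andP; split; first by near: e; exact: nbhs_right_gt.
by near: e; exact: nbhs_right_lt.
Unshelve. all: by end_near. Qed.

Lemma growth_lt S s : (growth S < s%:E)%E ->
  \forall e \near 0^'+, exists2 n, S e n & n%:R < e `^ (- s).
Proof.
move=> /ereal_inf_lt[_ [V V0 <-]] Vs.
near=> e; apply/growth_ratio_lt; first by near: e; exact: near0_lt1.
apply: le_lt_trans Vs; apply: ereal_sup_ubound; exists e => //.
by near: e.
Unshelve. all: by end_near. Qed.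

Lemma growth_le S s :
  (\forall e \near 0^'+, exists2 n, S e n & n%:R < e `^ (- s)) ->
  (growth S <= s%:E)%E.
Proof.
move=> Ss; pose V e := 0 < e < 1 /\ exists2 n, S e n & n%:R < e `^ (- s).
apply: (@le_trans _ _ (ereal_sup (growth_ratio S @` V))).
  apply: ereal_inf_lbound; exists V => //.
  by apply: filterS2 near0_lt1 Ss => e; split.
by apply: ge_ereal_sup => _ [e [e01 ee] <-]; apply/ltW/growth_ratio_lt.
Qed.

(** A negative growth forces the count to be 0 at all small scales, whence every exponent is
    admissible and the growth is [-oo], which [fine] sends to 0. *)
Lemma growth_fine_ge0 S : 0 <= fine (growth S).
Proof.
case E : (growth S) => [r||] //=; rewrite leNgt; apply/negP => r0.
have : (growth S <= (r - 1)%:E)%E; last by rewrite E lee_fin; lra.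
apply: growth_le; have := @growth_lt S 0; rewrite E lte_fin => /(_ r0) S0.
near=> e; have [//|n Sn] := near S0 e; rewrite oppr0 powRr0 ltrn1 ltnS leqn0 => /eqP n0.
exists n => //; rewrite n0; apply: powR_gt0.
by near: e; exact: nbhs_right_gt.
Unshelve. all: by end_near. Qed.

Lemma growth_fine_lt S s : (growth S < +oo)%E -> fine (growth S) < s ->
  \forall e \near 0^'+, exists2 n, S e n & n%:R <= e `^ (- s).
Proof.
move=> Soo Ss; have : (growth S < s%:E)%E.
  by case: (growth S) Soo Ss => [r||] //=; rewrite ?lte_fin ?ltNyr.
by move=> /growth_lt; apply: filterS => e [n Sn /ltW]; exists n.
Qed.

Lemma growth_lty S T : (forall e n, 0 < e -> S e n -> exists2 m, T e m & (m <= n)%N) ->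
  (growth S < +oo)%E -> (growth T < +oo)%E.
Proof.
move=> ST Soo; have [s Ss] : exists s : R, (growth S < s%:E)%E.
  case: (growth S) Soo => [r||] // _; last by exists 0; rewrite ltNyr.
  by exists (r + 1); rewrite lte_fin ltrDl.
apply: (@le_lt_trans _ _ s%:E); last by rewrite ltry.
apply: growth_le; have Sn := growth_lt Ss.
near=> e; have e0 : 0 < e by near: e; exact: nbhs_right_gt.
have [//|n Sen ne] := near Sn e; have [m Tm mn] := ST _ _ e0 Sen.
by exists m => //; apply: le_lt_trans ne; rewrite ler_nat.
Unshelve. all: by end_near. Qed.

End GrowthExponent.

(** A spanning family is thinned to a basis: by induction, the first vector either lies in the span
    of the basis found for the others or is added to it. *)
Lemma exists_basis (R : realType) (B : lmodType R) (n : nat) (c : 'I_n -> B) :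
  exists2 m, (m <= n)%N & exists2 V, subspace_of_dim m V & forall i, V (c i).
Proof.
elim: n c => [c|n IH c].
  exists 0%N => //; exists (range (fun a : 'I_0 -> R => \sum_(i < 0) a i *: (0 : B))).
    by exists (fun=> 0) => // a _ [].
  by case.
have [m mn [_ [b bfree ->] bc]] := IH (fun i => c (lift ord0 i)).
have [[a _ ac0]|nc0] := pselect (range (fun a => \sum_i a i *: b i) (c ord0)).
  exists m; first exact: leqW; exists (range (fun a => \sum_i a i *: b i)).
    by exists b.
  by move=> i; case: (unliftP ord0 i) => [j ->|->]; [exact: bc|exists a].
pose b' (i : 'I_m.+1) := if unlift ord0 i is Some j then b j else c ord0.
have b'E a : \sum_i a i *: b' i = a ord0 *: c ord0 + \sum_i a (lift ord0 i) *: b i.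
  rewrite big_ord_recl /b' unlift_none; congr (_ + _).
  by apply: eq_bigr => i _; rewrite liftK.
exists m.+1 => //; exists (range (fun a => \sum_i a i *: b' i)).
  exists b' => // a; rewrite b'E => a0.
  have a00 : a ord0 = 0.
    apply: contra_notP nc0 => /eqP a00; exists (fun i => - (a ord0)^-1 * a (lift ord0 i)) => //.
    apply: (scalerI a00); rewrite scaler_sumr; apply/esym/eqP.
    rewrite -subr_eq0 -sumrN -[eqbRHS]a0; apply/eqP; congr (_ + _).
    apply: eq_bigr => i _.
    by rewrite !scalerA mulrA mulrN divff// mulN1r scaleNr opprK.
  move: a0; rewrite a00 scale0r add0r => /bfree a0 i.
  by case: (unliftP ord0 i) => [j ->|->].
move=> i; case: (unliftP ord0 i) => [j ->|->].
  have [a _ <-] := bc j.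
  exists (fun i => if unlift ord0 i is Some k then a k else 0) => //.
  rewrite b'E unlift_none scale0r add0r.
  by apply: eq_bigr => k _; rewrite liftK.
exists (fun i => if i == ord0 then 1 else 0) => //.
by rewrite b'E eqxx scale1r big1 ?addr0// => k _; rewrite scale0r.
Qed.

Section Dimensions.
Context {R : realType} {B : normedModType R} (X : set B).

Definition covers (e : R) : set nat := [set n : nat |
    exists2 c : 'I_n -> B, (forall i, X (c i)) &
      X `<=` \bigcup_(i in [set: 'I_n]) ball (c i) e].

Definition approximations (e : R) : set nat := [set n : nat |
    exists2 V : set B, subspace_of_dim n V &
      forall x, X x -> dist_to x V <= e].

Lemma box_dimE : box_dim X = growth covers. Proof. by []. Qed.

Lemma thickness_exponentE : thickness_exponent X = growth approximations.
Proof. by []. Qed.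

Lemma dist_to_le (V : set B) (x v : B) : V v -> dist_to x V <= `|x - v|.
Proof. by move=> Vv; apply: ge_inf; [exists 0 => _ [w _ <-]|exists v]. Qed.

Lemma dist_to_lt (V : set B) (x : B) (e : R) : V !=set0 -> dist_to x V < e ->
  exists2 v, V v & `|x - v| < e.
Proof.
move=> [w Vw] xe.
have [|_ [v Vv <-] ve] := @inf_lt _ [set `|x - v| | v in V] _ _ xe; last by exists v.
by exists `|x - w|, w.
Qed.

(** The span of the centres of an [e]-cover approximates [X] within [e]. *)
Lemma thickness_lty : (box_dim X < +oo)%E -> (thickness_exponent X < +oo)%E.
Proof.
rewrite box_dimE thickness_exponentE; apply: growth_lty => e n e0 [c Xc cov].
have [m mn [V Vm Vc]] := exists_basis c; exists m => //; exists V => // x /cov[i _].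
by rewrite -ball_normE /= distrC => /ltW; apply: le_trans; exact: dist_to_le.
Qed.

End Dimensions.

(** * Functionals adapted to one scale *)

Section GramSchmidt.
Context {R : realType} {P : finType}.
Implicit Types u v w : P -> R.

Definition dot u v : R := \sum_p u p * v p.

Lemma dotC u v : dot u v = dot v u.
Proof. by apply: eq_bigr => p _; rewrite mulrC. Qed.

Lemma dotDr u v w : dot u (fun p => v p + w p) = dot u v + dot u w.
Proof. by rewrite -big_split; apply: eq_bigr => p _; rewrite mulrDr. Qed.

Lemma dotZr u (a : R) v : dot u (fun p => a * v p) = a * dot u v.
Proof. by rewrite mulr_sumr; apply: eq_bigr => p _; rewrite mulrCA. Qed.

Lemma dot_sumr u n (a : 'I_n -> R) (w : 'I_n -> P -> R) :
  dot u (fun p => \sum_i a i * w i p) = \sum_i a i * dot u (w i).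
Proof.
rewrite /dot; under eq_bigr do rewrite mulr_sumr.
rewrite exchange_big; apply: eq_bigr => i _.
by rewrite mulr_sumr; apply: eq_bigr => p _; rewrite mulrCA.
Qed.

Lemma dot_ge0 u : 0 <= dot u u.
Proof. by apply: sumr_ge0 => p _; rewrite -expr2 sqr_ge0. Qed.

Lemma dot_eq0 u : dot u u = 0 -> u = fun=> 0.
Proof.
move=> u0; apply/funext => p; apply/eqP; rewrite -sqrf_eq0 expr2.
by rewrite (psumr_eq0P _ u0)// => q _; rewrite -expr2 sqr_ge0.
Qed.

(* Null vectors are allowed so that linearly dependent families can be
   orthonormalised without discarding indices. *)
Definition orthonormal0 n (w : 'I_n -> P -> R) :=
  exists z : 'I_n -> bool, forall i j, dot (w i) (w j) = ((i == j) && z i)%:R.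

(** Pythagoras, with an inequality because the null vectors contribute nothing on the left. *)
Lemma orthonormal0_comb n (w : 'I_n -> P -> R) (g : 'I_n -> R) : orthonormal0 w ->
  dot (fun p => \sum_i g i * w i p) (fun p => \sum_i g i * w i p)
    <= \sum_i g i ^+ 2.
Proof.
move=> [z wz]; rewrite dot_sumr; apply: ler_sum => i _.
rewrite dotC dot_sumr (bigD1 i)//= big1 ?addr0 => [|j ji].
  rewrite wz eqxx/=; case: (z i); rewrite ?mulr1 ?expr2 // !mulr0 -expr2.
  exact: sqr_ge0.
by rewrite wz eq_sym (negbTE ji) mulr0.
Qed.

(** Expansion of the squared norm of [v] minus its projection, which is nonnegative. *)
Lemma bessel n (w : 'I_n -> P -> R) v : orthonormal0 w ->
  \sum_i dot (w i) v ^+ 2 <= dot v v.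
Proof.
move=> ow; pose c i := - dot (w i) v.
pose h p := \sum_i c i * w i p.
have := dot_ge0 (fun p => v p + h p).
rewrite dotDr !(dotC (fun p => v p + h p)) !dotDr.
have hh : dot h h <= \sum_i dot (w i) v ^+ 2.
  apply: le_trans (orthonormal0_comb c ow) _.
  by apply: ler_sum => i _; rewrite sqrrN.
have vh : dot v h = - \sum_i dot (w i) v ^+ 2.
  by rewrite dot_sumr -sumrN; apply: eq_bigr => i _; rewrite mulNr dotC expr2.
by rewrite (dotC h v) vh; lra.
Qed.

Lemma gram_schmidt n (u : 'I_n -> P -> R) :
  exists2 w : 'I_n -> P -> R, orthonormal0 w &
    forall i p, u i p = \sum_j dot (w j) (u i) * w j p.
Proof.
elim: n u => [u|n IH u].
  by exists u => [|[]//]; exists xpredT => -[].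
have [w [z wz] uw] := IH (fun i => u (lift ord0 i)).
pose r p := u ord0 p - \sum_j dot (w j) (u ord0) * w j p.
have rE : r = fun p => u ord0 p + \sum_j (- dot (w j) (u ord0)) * w j p.
  by apply/funext => p; rewrite /r -sumrN; congr (_ + _); apply: eq_bigr => j _; rewrite mulNr.
have wr i : dot (w i) r = 0.
  rewrite rE dotDr dot_sumr (bigD1 i)//= big1 => [|j ji].
    rewrite addr0 wz eqxx/=; case: (boolP (z i)) => zi; first by rewrite mulr1 subrr.
    suff -> : w i = fun=> 0 by rewrite /dot big1 ?mulr0 ?addr0// => p _; rewrite mul0r.
    by apply: dot_eq0; rewrite wz (negbTE zi) andbF.
  by rewrite wz eq_sym (negbTE ji) mulr0.
pose s := Num.sqrt (dot r r).
have ssq : s ^+ 2 = dot r r by rewrite sqr_sqrtr// dot_ge0.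
(* If the residue [r] vanishes then [s = 0], its inverse is 0 by convention, and [w0] is one of the
   allowed null vectors. *)
pose w0 p := s^-1 * r p.
have w0r v : dot w0 v = s^-1 * dot r v by rewrite dotC dotZr dotC.
have w0w i : dot w0 (w i) = 0 by rewrite w0r dotC wr mulr0.
have w0w0 : dot w0 w0 = (s != 0)%:R.
  rewrite w0r dotZr -ssq; have [->|s0] := eqVneq s 0; first by rewrite invr0 mul0r.
  by rewrite expr2 mulKf// mulVf.
have ru0 : dot r (u ord0) = s ^+ 2.
  rewrite ssq {3}rE dotDr dot_sumr -[LHS]addr0; congr (_ + _).
  by rewrite big1// => j _; rewrite (dotC r) wr mulr0.
pose w' i := if unlift ord0 i is Some j then w j else w0.
have w'0 : w' ord0 = w0 by rewrite /w' unlift_none.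
have w'S i : w' (lift ord0 i) = w i by rewrite /w' liftK.
exists w'.
  exists (fun i => if unlift ord0 i is Some j then z j else s != 0) => i j.
  case: (unliftP ord0 i) => [i' ->|->]; case: (unliftP ord0 j) => [j' ->|->].
  - by rewrite !w'S wz (inj_eq (@lift_inj _ ord0)).
  - by rewrite w'S w'0 dotC w0w eq_sym (negbTE (neq_lift _ _)).
  - by rewrite w'S w'0 w0w (negbTE (neq_lift _ _)).
  - by rewrite w'0 w0w0 eqxx.
move=> i p; rewrite big_ord_recl w'0; under eq_bigr do rewrite w'S.
case: (unliftP ord0 i) => [j ->|->].
  rewrite -uw (_ : dot w0 _ = 0) ?mul0r ?add0r//.
  have -> : u (lift ord0 j) = fun p => \sum_l dot (w l) (u (lift ord0 j)) * w l p.
    by apply/funext => q; exact: uw.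
  by rewrite dot_sumr big1// => l _; rewrite w0w mulr0.
rewrite w0r ru0 -[LHS](subrK (\sum_j dot (w j) (u ord0) * w j p)) -/(r p).
congr (_ + _); have [s0|s0] := eqVneq s 0.
  rewrite s0 expr0n mulr0 mul0r; have := dot_eq0 (u := r).
  by rewrite -ssq s0 expr0n => ->.
by rewrite /w0 expr2 mulKf// mulrA divff// mul1r.
Qed.

(** The expansion of each [u i] in [w] passes to their combination [v]; pairing that expansion with
    [v] gives the equality case of Bessel. *)
Lemma parseval_span n (u w : 'I_n -> P -> R) v (a : 'I_n -> R) :
  (forall i p, u i p = \sum_j dot (w j) (u i) * w j p) ->
  (forall p, v p = \sum_i a i * u i p) ->
  dot v v = \sum_j dot (w j) v ^+ 2.
Proof.
move=> uw vu; have vw p : v p = \sum_j dot (w j) v * w j p.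
  rewrite vu; under eq_bigr do rewrite uw mulr_sumr.
  rewrite exchange_big; apply: eq_bigr => j _.
  have -> : v = fun p => \sum_i a i * u i p by exact/funext.
  by rewrite dot_sumr mulr_suml; apply: eq_bigr => i _; rewrite mulrA.
have {2}-> : v = fun p => \sum_j dot (w j) v * w j p by exact/funext.
by rewrite dot_sumr; apply: eq_bigr => j _; rewrite expr2 (dotC v).
Qed.

End GramSchmidt.

Lemma near0_threshold (R : realType) (Q : R -> Prop) :
  (\forall e \near 0^'+, Q e) ->
  exists2 e0, 0 < e0 & forall e, 0 < e < e0 -> Q e.
Proof.
case=> e0 /= e00 eQ; exists e0 => // e /andP[e0' ee0]; apply: eQ => //.
by rewrite /ball/= sub0r normrN gtr0_norm.
Qed.

Lemma ord_lt0n m (i : 'I_m) : (0 < m)%N.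
Proof. exact: leq_ltn_trans (ltn_ord i). Qed.

Section Block.
Context {R : realType} {B : normedModType R} (X : set B).

Lemma norming_family (n : nat) (c : 'I_n -> B) :
  exists2 f : 'I_n * 'I_n -> {scalar B},
    (forall p x, `|f p x| <= `|x|) &
    forall i j, f (i, j) (c i - c j) = `|c i - c j|.
Proof.
have [f fP] := choice (fun p : 'I_n * 'I_n =>
  let: ex_intro2 f f1 f2 := norming_functional (c p.1 - c p.2) in
  ex_intro (fun f : {scalar B} => (forall x, `|f x| <= `|x|) /\
    f (c p.1 - c p.2) = `|c p.1 - c p.2|) f (conj f1 f2)).
by exists f => [p x|i j]; [case: (fP p) => + _; apply|case: (fP (i, j))].
Qed.

Lemma dot_functionals_le (P : finType) (f : P -> B -> R) x :
  (forall p, `|f p x| <= `|x|) -> dot (f^~ x) (f^~ x) <= #|P|%:R * `|x| ^+ 2.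
Proof.
move=> fx; rewrite mulr_natl -sumr_const; apply: ler_sum => p _.
by rewrite -expr2 -real_normK ?num_real// ler_pXn2r ?nnegrE.
Qed.

(** Termwise this is [(u p - 2 * v p) ^+ 2 >= 0]. *)
Lemma dot_split (P : finType) (u v : P -> R) :
  dot u u <= 2 * dot v v + 2 * dot (fun p => u p - v p) (fun p => u p - v p).
Proof.
rewrite /dot !mulr_sumr -big_split; apply: ler_sum => p _ /=.
by have := sqr_ge0 (u p - 2 * v p); rewrite expr2; lra.
Qed.

Lemma sum_dot_split (P : finType) m (w : 'I_m -> P -> R) (u v : P -> R) :
  \sum_i dot (w i) u ^+ 2 <=
  2 * (\sum_i dot (w i) v ^+ 2) + 2 * \sum_i dot (w i) (fun p => u p - v p) ^+ 2.
Proof.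
rewrite !mulr_sumr -big_split; apply: ler_sum => i _ /=.
have -> : dot (w i) (fun p => u p - v p) = dot (w i) u - dot (w i) v.
  rewrite -mulN1r -dotZr -dotDr; congr dot; apply/funext => p.
  by rewrite mulN1r.
by have := sqr_ge0 (dot (w i) u - 2 * dot (w i) v); rewrite !expr2; lra.
Qed.

(* Up to the factor [1 / (n.+1 ^ 2 * m)], the sum of the [psi i z ^+ 2] is the
   squared norm of the projection of [F z] onto [F V], where [F] collects the
   norming functionals of the differences of the centres of an [e/8]-cover and
   [V] approximates [X] within [e / (32 * n.+1)]. *)
Lemma projected_functionals (n m : nat) (e : R) : 0 < e ->
  covers X (e / 8) n.+1 -> approximations X (e / (32 * n.+1%:R)) m ->
  exists psi : 'I_m -> B -> R, [/\ forall i, scalar (psi i),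
    forall (g : 'I_m -> R) x, `|\sum_i g i * psi i x| <=
      (1 + (\sum_i g i ^+ 2) / m%:R) * `|x| &
    forall x y, X x -> X y -> e <= `|x - y| ->
      e ^+ 2 <= 32 * n.+1%:R ^+ 2 * m%:R * \sum_i psi i (x - y) ^+ 2].
Proof.
move=> e0 [c Xc cov] [V [b _ VE] XV].
set N : R := n.+1%:R; have N0 : 0 < N by rewrite ltr0n.
have [f f1 fc] := norming_family c.
pose F x : 'I_n.+1 * 'I_n.+1 -> R := fun p => f p x.
have FB x y : F (x - y) = fun p => F x p - F y p.
  by apply/funext => p; rewrite /F linearB.
have Fle x : dot (F x) (F x) <= N ^+ 2 * `|x| ^+ 2.
  have := @dot_functionals_le _ (fun p => f p : B -> R) x (fun p => f1 p x).
  by rewrite card_prod card_ord natrM -expr2.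
(* The [w i] span the image of [V] under [F]; the [F (b i)] may be dependent although the [b i] are
   not. *)
have [w ow uw] := gram_schmidt (fun i => F (b i)).
pose h (g : 'I_m -> R) p := \sum_i g i * w i p.
have Nm0 : 0 <= N * Num.sqrt m%:R by rewrite mulr_ge0 ?sqrtr_ge0 ?ltW.

exists (fun i x => dot (w i) (F x) / (N * Num.sqrt m%:R)); split.
- move=> i a x y; rewrite mulrA -mulrDl; congr (_ / _).
  rewrite -dotZr -dotDr; congr dot; apply/funext => p.
  by rewrite /F linearP.
- move=> g x; have [m0|m0] := posnP m.
    rewrite big1 => [|i]; last by move: (ord_lt0n i); rewrite m0.
    by rewrite normr0 mulr_ge0// addr_ge0// divr_ge0// sumr_ge0// => i _; exact: sqr_ge0.
  have sm0 : 0 < Num.sqrt (m%:R : R) by rewrite sqrtr_gt0 ltr0n.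
  have -> : \sum_i g i * (dot (w i) (F x) / (N * Num.sqrt m%:R)) =
      \sum_p h g p / (N * Num.sqrt m%:R) * F x p.
    under eq_bigr do rewrite mulrA; rewrite -mulr_suml.
    have -> : \sum_i g i * dot (w i) (F x) = dot (F x) (h g).
      by rewrite dot_sumr; apply: eq_bigr => i _; rewrite dotC.
    rewrite mulr_suml; apply: eq_bigr => p _; ring.
  (* In each coordinate [al * be <= (al^2 + be^2) / 2] with [al = 1 / N]; over the [N^2] coordinates
     the first halves add up to [1 / 2]. *)
  apply: (@le_trans _ _ (\sum_(p : 'I_n.+1 * 'I_n.+1)
      ((N ^+ 2)^-1 / 2 + h g p * h g p / m%:R / 2) * `|x|)).
    apply: le_trans (ler_norm_sum _ _ _) _; apply: ler_sum => p _.
    rewrite normrM; apply: ler_pM => //; last exact: f1.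
    rewrite normrM normfV (ger0_norm Nm0).
    pose al := N^-1; pose be := `|h g p| / Num.sqrt m%:R.
    have -> : `|h g p| / (N * Num.sqrt m%:R) = al * be by rewrite invfM mulrCA.
    have -> : (N ^+ 2)^-1 = al ^+ 2 by rewrite exprVn.
    have -> : h g p * h g p / m%:R = be ^+ 2.
      by rewrite expr_div_n sqr_sqrtr// real_normK ?num_real.
    have := sqr_ge0 (al - be); rewrite sqrrB -mulr_natr; lra.
  rewrite -mulr_suml ler_wpM2r// big_split/=; apply: lerD.
    rewrite sumr_const card_prod card_ord -[leLHS]mulr_natl natrM -expr2 -/N mulrA.
    by rewrite divff ?expf_neq0 ?gt_eqF//; lra.
  rewrite -!mulr_suml -/(dot (h g) (h g)).
  have := orthonormal0_comb g ow; rewrite -/(h g) => hg.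
  have hg0 := dot_ge0 (h g).
  apply: (@le_trans _ _ (dot (h g) (h g) / m%:R)).
    by rewrite ler_pdivrMr// mulrDr mulr1 lerDl divr_ge0.
  by rewrite ler_wpM2r// invr_ge0.
move=> x y Xx Xy exy.
have V0 : V !=set0 by rewrite VE; eexists; exists (fun=> 0).
(* The infimum defining the distance need not be attained, so the radius is doubled from
   [e / (32 * N)]. *)
have near_V z : X z -> exists2 v, V v & `|z - v| < e / (16 * N).
  move=> Xz; apply: dist_to_lt => //; apply: le_lt_trans (XV _ Xz) _.
  rewrite ltr_pM2l// ltf_pV2 ?posrE ?mulr_gt0// ltr_pM2r//.
  by rewrite ltr_nat.
have [vx Vx xvx] := near_V _ Xx; have [vy Vy yvy] := near_V _ Xy.
pose z := x - y; pose v := vx - vy.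
have zv : `|z - v| <= e / (8 * N).
  have -> : z - v = (x - vx) - (y - vy).
    by rewrite /z /v !opprB [vy - vx]addrC addrACA [- y + vy]addrC.
  apply: le_trans (ler_normB _ _) _.
  have -> : e / (8 * N) = e / (16 * N) + e / (16 * N) by field; rewrite gt_eqF.
  by apply/ltW/ltrD.
have dzv : dot (F (z - v)) (F (z - v)) <= e ^+ 2 / 64.
  apply: le_trans (Fle _) _.
  have -> : e ^+ 2 / 64 = N ^+ 2 * (e / (8 * N)) ^+ 2 by field; rewrite gt_eqF.
  rewrite ler_pM2l ?exprn_gt0// ler_pXn2r ?nnegrE//.
  by rewrite divr_ge0 ?mulr_ge0 ?ltW.
have dz : e ^+ 2 / 4 <= dot (F z) (F z).
  have [i _ ix] := cov _ Xx; have [j _ jy] := cov _ Xy.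
  move: ix jy; rewrite -!ball_normE /= => ix jy.
  have zc : `|z - (c i - c j)| < e / 4.
    have -> : z - (c i - c j) = (c j - y) - (c i - x).
      by rewrite /z !opprB [x - y]addrC addrACA [- y + c j]addrC.
    apply: le_lt_trans (ler_normB _ _) _.
    by rewrite (_ : e / 4 = e / 8 + e / 8) ?ltrD//; field.
  (* The difference of centres has norm at least [3e/4], which [f (i, j)] attains, and replacing it
     by [z] costs at most [e/4]. *)
  have fz : e / 2 <= `|f (i, j) z|.
    have h1 := f1 (i, j) (z - (c i - c j)).
    have h2 := ler_norm (f (i, j) (c i - c j) - f (i, j) z).
    have h3 := ler_norm (f (i, j) z).
    have h4 := ler_normD (z - (c i - c j)) (c i - c j).
    rewrite subrK in h4.
    rewrite linearB distrC in h1.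
    move: h2; rewrite fc => h2.
    have : e <= `|z| by [].
    rewrite fc in h1; lra.
  rewrite /dot (bigD1 (i, j))//= -[leLHS]addr0; apply: lerD; last first.
    by apply: sumr_ge0 => p _; rewrite -expr2 sqr_ge0.
  rewrite -expr2 -[leRHS]real_normK ?num_real// (_ : e ^+ 2 / 4 = (e / 2) ^+ 2); last by field.
  by rewrite ler_pXn2r ?nnegrE// divr_ge0// ltW.
have Fv : dot (F v) (F v) = \sum_i dot (w i) (F v) ^+ 2.
  move: Vx Vy; rewrite VE => -[a _ ax] [a' _ ay].
  apply: (parseval_span uw (a := fun i => a i - a' i)) => p.
  rewrite /F /v -ax -ay -sumrB linear_sum; apply: eq_bigr => i _.
  by rewrite -scalerBl linearZ.
have h1 := dot_split (F z) (F v); rewrite -FB in h1.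
have h2 := sum_dot_split w (F v) (F z); rewrite -FB in h2.
have h3 := bessel (F (v - z)) ow.
have h4 : dot (F (v - z)) (F (v - z)) <= e ^+ 2 / 64.
  move: dzv; congr (_ <= _); rewrite -[v - z]opprB /dot; apply: eq_bigr => p _.
  by rewrite /F !linearN mulrNN.
set A := \sum_i dot (w i) (F z) ^+ 2 in h2.
(* From [e^2/4 <= 2 |F v|^2 + e^2/32] one gets [|F v|^2 >= 7 e^2/64], and [|F v|^2 <= 2 A + e^2/32]
   then gives [A >= 5 e^2/128]. *)
have A32 : e ^+ 2 / 32 <= A by rewrite Fv in h1; have := sqr_ge0 e; lra.
have [m0|m0] := posnP m.
  exfalso; move: A32; rewrite /A big1 => [|i]; last by move: (ord_lt0n i); rewrite m0.
  by rewrite leNgt divr_gt0// exprn_gt0.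
rewrite (_ : \sum_i _ = A / (N ^+ 2 * m%:R)); last first.
  rewrite /A mulr_suml; apply: eq_bigr => i _.
  by rewrite expr_div_n exprMn sqr_sqrtr.
rewrite (_ : _ * (A / _) = 32 * A); first lra.
by rewrite -/N; field; rewrite !gt_eqF// ltr0n.
Qed.

End Block.

Lemma powR_small (R : realType) (K a : R) : 0 < a ->
  exists2 e0, 0 < e0 & forall e, 0 < e < e0 -> K * e `^ a <= 1.
Proof.
move=> a0; apply: near0_threshold.
have : K * e `^ a @[e --> 0^'+] --> K * 0.
  by apply: cvgMr; exact: powR_cvg0.
rewrite mulr0 => /cvgr_lt /(_ 1 ltr01); apply: filterS => e; exact: ltW.
Qed.

Lemma powR_invr (R : realType) (x r : R) : 0 <= x -> (x^-1) `^ r = x `^ (- r).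
Proof. by move=> x0; rewrite -powR_inv1// -powRrM mulN1r. Qed.

(** With [n] of order [e^-d] and [m] of order [(e/n)^-t], the factor [n^2 * m] is at most a constant
    times [e^-(2d + (1+d)t)], and [2 + 2d + (1+d)t] is twice [(1+d)(1+t/2)]. The strict excess of
    [s] absorbs the constants for small [e]. *)
Lemma block_functionals (R : realType) (B : normedModType R) (X : set B)
    (d t s : R) : 0 <= d -> 0 <= t -> (1 + d) * (1 + t / 2) < s ->
  (\forall e \near 0^'+, exists2 n, covers X e n & n%:R <= e `^ (- d)) ->
  (\forall e \near 0^'+, exists2 n, approximations X e n & n%:R <= e `^ (- t)) ->
  exists2 e0, 0 < e0 & forall e, 0 < e < e0 ->
  exists (m : nat) (psi : nat -> B -> R), [/\ forall i, scalar (psi i),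
    forall (g : nat -> R) x, `|\sum_(i < m) g i * psi i x| <=
      (1 + (\sum_(i < m) g i ^+ 2) / m%:R) * `|x| &
    forall x y, X x -> X y -> e <= `|x - y| ->
      (e `^ s) ^+ 2 <= \sum_(i < m) psi i (x - y) ^+ 2].
Proof.
move=> d0 t0 ds /near0_threshold[e1 e10 H1] /near0_threshold[e2 e20 H2].
pose ka := s - (1 + d) * (1 + t / 2).
have ka0 : 0 < ka by rewrite subr_gt0.
pose K := 32 * (8 `^ d) ^+ 2 * (32 * 8 `^ d) `^ t : R.
have [|e3 e30 H3] := @powR_small _ K (2 * ka); first by rewrite mulr_gt0.
exists (Num.min e1 (Num.min e2 e3)); first by rewrite !lt_min e10 e20 e30.
move=> e /andP[e0]; rewrite !lt_min => /and3P[ee1 ee2 ee3].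
have [n Xn nd] := H1 (e / 8) ltac:(apply/andP; split; lra).
(* A cover by no balls means that [X] is empty, and an empty block suffices. *)
case: n Xn nd => [[c Xc cov] _|n Xn nd].
  exists 0%N, (fun=> fun=> 0); split.
  - by move=> i a x y; rewrite mulr0 addr0.
  - by move=> g x; rewrite !big_ord0 mul0r addr0 mul1r normr0.
  - by move=> x y /cov[[]].
pose N : R := n.+1%:R; have N0 : 0 < N by rewrite ltr0n.
have N1 : 1 <= N by rewrite ler1n.
have e20' : 0 < e / (32 * N) < e2.
  apply/andP; split; first by rewrite divr_gt0 ?mulr_gt0.
  by rewrite ltr_pdivrMr ?mulr_gt0//; nra.
have [m Xm mt] := H2 _ e20'.
have [psi [psil psile psige]] := projected_functionals e0 Xn Xm.
(* Extension by zero to all indices, so that blocks of different lengths have one type. *)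
pose psi' i := if insub i is Some j then psi j else fun=> 0.
have psi'E (i : 'I_m) : psi' i = psi i by rewrite /psi' valK.
exists m, psi'; split.
- move=> i; rewrite /psi'; case: insub => [j|]; first exact: psil.
  by move=> a x y; rewrite mulr0 addr0.
- by move=> g x; under eq_bigr do rewrite psi'E; exact: (psile (fun i => g i)).
move=> x y Xx Xy exy; under eq_bigr do rewrite psi'E.
have := psige _ _ Xx Xy exy; rewrite -/N.
set A := \sum_i _ => eA.
have A0 : 0 <= A by apply: sumr_ge0 => i _; exact: sqr_ge0.
have eNd : N <= 8 `^ d * e `^ (- d).
  apply: le_trans nd _; rewrite powRM ?invr_ge0 ?(ltW e0)// mulrC.
  by rewrite powR_invr// opprK.
have em : m%:R <= (32 * 8 `^ d) `^ t * e `^ (- ((1 + d) * t)).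
  apply: le_trans mt _; rewrite -powR_invr; last by rewrite divr_ge0 ?mulr_ge0 ?ltW.
  rewrite invf_div -mulNr powRrM -powRM ?mulr_ge0 ?powR_ge0//.
  apply: ge0_ler_powR => //.
  - by rewrite nnegrE divr_ge0 ?mulr_ge0 ?ltW.
  - by rewrite nnegrE !mulr_ge0 ?powR_ge0.
  rewrite -!mulrA ler_pM2l// opprD powRD; last by rewrite (lt0r_neq0 e0) implybT.
  rewrite powR_inv1 ?(ltW e0)// [e^-1 * _]mulrC mulrA.
  by rewrite ler_pM2r// invr_gt0.
have NmK : 32 * N ^+ 2 * m%:R <= K * e `^ (- (2 * d + (1 + d) * t)).
  have -> : K * e `^ (- (2 * d + (1 + d) * t)) =
     32 * (8 `^ d * e `^ (- d)) ^+ 2 * ((32 * 8 `^ d) `^ t * e `^ (- ((1 + d) * t))).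
    rewrite exprMn -[(e `^ (- d)) ^+ 2]powR_mulrn ?powR_ge0// -powRrM.
    rewrite opprD powRD; last by rewrite (lt0r_neq0 e0) implybT.
    by rewrite /K -[- d * 2%:R]mulrC mulrN; ring.
  apply: ler_pM => //; first by rewrite mulr_ge0// exprn_ge0 ?ltW.
  rewrite ler_pM2l// ler_pXn2r// nnegrE; first exact: ltW.
  by rewrite mulr_ge0 ?powR_ge0.
pose q := e `^ (- (2 * d + (1 + d) * t)).
have q0 : 0 < q by exact: powR_gt0.
have KA : e ^+ 2 <= K * q * A by apply: le_trans eA _; rewrite ler_wpM2r.
have sE : (e `^ s) ^+ 2 * q = e `^ (2 * ka) * e ^+ 2.
  rewrite -!powR_mulrn ?powR_ge0 ?ltW// -powRrM -!powRD; last 2 first.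
    by rewrite (lt0r_neq0 e0) implybT.
    by rewrite (lt0r_neq0 e0) implybT.
  by congr powR; rewrite /ka; field.
have K1 := H3 e ltac:(by apply/andP).
have [K0|K0] := leP K 0.
  have : K * q * A <= 0 by rewrite -mulrA mulr_le0_ge0// mulr_ge0// ltW.
  by have : 0 < e ^+ 2 by [rewrite exprn_gt0]; lra.
rewrite -(ler_pM2r q0) sE -(ler_pM2l K0) mulrA.
apply: (@le_trans _ _ (e ^+ 2)).
  by rewrite ler_piMl// exprn_ge0// ltW.
by apply: le_trans KA _; rewrite -mulrA [q * A]mulrC.
Qed.

(** * Combining the scales *)

Lemma prod_gbump (R : realType) (I : Type) (r : seq I) (S : R) (x : I -> R) :
  \prod_(i <- r) gbump S (x i) = expR (- ((\sum_(i <- r) x i ^+ 2) / (2 * S))).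
Proof.
elim: r => [|i r IH]; first by rewrite !big_nil mul0r oppr0 expR0.
by rewrite !big_cons IH -expRD -opprD -mulrDl.
Qed.

Lemma ler_sum_term (R : realType) (I : eqType) (r : seq I) (F : I -> R) (i : I) :
  (forall j, 0 <= F j) -> i \in r -> F i <= \sum_(j <- r) F j.
Proof.
by move=> F0 ir; rewrite (big_rem _ ir)/= lerDl sumr_ge0.
Qed.

Lemma sum_scalar (R : realType) (B : lmodType R) (I : Type) (r : seq I)
    (c : I -> R) (f : I -> B -> R) : (forall i, scalar (f i)) ->
  scalar (fun x => \sum_(i <- r) c i * f i x).
Proof.
move=> fl a x y; rewrite mulr_sumr -big_split; apply: eq_bigr => i _ /=.
by rewrite fl; ring.
Qed.

(** The last two hypotheses bound the Gaussian averages of the penalty and of the bumps by [1/4]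
    each, so some coefficients keep their sum at most [1/2]. The penalty then bounds the
    functionals, and a bump product of at most [1/2] keeps [L z] away from 0. *)
Lemma finite_stage (R : realType) (B : normedModType R) (k : nat) (ns : seq nat)
    (m : nat -> nat) (psi : nat -> nat -> B -> R) (rho s t : nat -> R)
    (Z : nat -> seq B) :
  (0 < k)%N -> uniq ns ->
  (forall n i, scalar (psi n i)) ->
  (forall n, n \in ns -> forall (g : nat -> R) x,
    `|\sum_(i < m n) g i * psi n i x| <=
      (1 + (\sum_(i < m n) g i ^+ 2) / (m n)%:R) * `|x|) ->
  (forall n, 0 < rho n) -> (forall n, 0 < s n) -> (forall n, 0 < t n) ->
  (forall n z, n \in ns -> z \in Z n -> t n ^+ 2 <= \sum_(i < m n) psi n i z ^+ 2) ->
  k%:R * (Num.sqrt 2 * \sum_(n <- ns) rho n) <= 4^-1 ->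
  \sum_(n <- ns) (size (Z n))%:R * (s n / (rho n * t n)) ^+ k <= 4^-1 ->
  exists L : 'I_k -> B -> R, [/\ forall c, scalar (L c),
    forall c x, `|L c x| <= 3 * `|x| &
    forall n z, n \in ns -> z \in Z n -> s n ^+ 2 <= \sum_c L c z ^+ 2].
Proof.
move=> k0 uns psil psile rho0 s0 t0 tZ pen bad.
pose J := [seq (n, i) | n <- ns, i <- iota 0 (m n)].
pose P := [seq (n, z) | n <- ns, z <- Z n].
have uJ : uniq J.
  apply: allpairs_uniq_dep => // [n _|]; first exact: iota_uniq.
  by move=> [a b] [a' b'] _ _ /= [-> ->].
have sumJ (F : nat * nat -> R) :
    \sum_(j <- J) F j = \sum_(n <- ns) \sum_(i < m n) F (n, i : nat).
  rewrite big_allpairs_dep; apply: eq_bigr => n _.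
  by have -> : iota 0 (m n) = index_iota 0 (m n); rewrite ?big_mkord// /index_iota subn0.
have sumP (F : nat * B -> R) :
    \sum_(p <- P) F p = \sum_(n <- ns) \sum_(z <- Z n) F (n, z).
  by rewrite big_allpairs_dep.
pose S (p : nat * B) := s p.1 ^+ 2.
have S0 p : 0 < S p by rewrite exprn_gt0.
pose a (p : nat * B) (j : nat * nat) := rho j.1 * psi j.1 j.2 p.2.
(* Dividing by the block length makes the total penalty weight at most the sum of the [rho n], and
   matches the mean square in the block bound. *)
pose be (j : nat * nat) := rho j.1 / (m j.1)%:R.
have be0 j : 0 <= be j by rewrite divr_ge0// ltW.
have [G] := gbump_matrix P S0 a (fun=> 1) be k uJ.
set bad' := (X in X + _ <= _); set pen' := (X in _ + X <= _).
set bad'' := (X in _ <= X + _) => GP.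
have pen'0 : 0 <= pen'.
  by apply: sumr_ge0 => c _; apply: sumr_ge0 => j _; rewrite mulr_ge0 ?expR_ge0.
have bad'0 : 0 <= bad'.
  by apply: sumr_ge0 => p _; rewrite mul1r prodr_ge0// => c _; exact: expR_ge0.
have sumbe : \sum_(j <- J) be j <= \sum_(n <- ns) rho n.
  rewrite sumJ; apply: ler_sum => n _; rewrite /be /= sumr_const card_ord.
  rewrite -[leLHS]mulr_natr; have [->|m0] := eqVneq (m n) 0%N.
    by rewrite mulr0 ltW.
  by rewrite divfK// pnatr_eq0.
have bad''4 : bad'' <= 4^-1.
  apply: le_trans bad; rewrite /bad'' sumP big_seq [leRHS]big_seq.
  apply: ler_sum => n nns; rewrite -sum1_size natr_sum mulr_suml.
  rewrite big_seq [leRHS]big_seq; apply: ler_sum => z zZ.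
  rewrite !mul1r lerXn2r ?nnegrE ?sqrtr_ge0//.
    by rewrite divr_ge0 ?mulr_ge0 ?ltW.
  have rt0 : 0 < rho n * t n by rewrite mulr_gt0.
  rewrite -[leRHS]gtr0_norm ?divr_gt0// -sqrtr_sqr ler_wsqrtr//.
  rewrite expr_div_n /S /= ler_pM2l ?exprn_gt0//.
  (* Only the block of scale [n] is kept; the other scales can only increase the variance. *)
  have tA : (rho n * t n) ^+ 2 <= \sum_(j <- J) a (n, z) j ^+ 2.
    rewrite sumJ; apply: le_trans (ler_sum_term (i := n) _ nns); last first.
      by move=> l; apply: sumr_ge0 => i _; exact: sqr_ge0.
    rewrite exprMn; apply: (@le_trans _ _ (rho n ^+ 2 * \sum_(i < m n) psi n i z ^+ 2)).
      by rewrite ler_pM2l ?exprn_gt0// tZ.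
    by rewrite mulr_sumr; apply: ler_sum => i _; rewrite exprMn.
  have sq0 : 0 < s n ^+ 2 by rewrite exprn_gt0.
  rewrite lef_pV2 ?posrE ?exprn_gt0//; last by rewrite ltr_pwDl// (le_trans _ tA)// sqr_ge0.
  by rewrite (le_trans tA)// lerDr ltW.
have tot : bad' + pen' <= 2^-1.
  apply: (le_trans GP); rewrite (_ : 2^-1 = 4^-1 + 4^-1); last by field.
  apply: lerD => //; apply: le_trans pen.
  by rewrite ler_wpM2l// ler_wpM2l.
exists (fun c x => \sum_(j <- J) G c j * (rho j.1 * psi j.1 j.2 x)); split.
- move=> c; apply: sum_scalar => j u x y.
  by rewrite psil; ring.
- move=> c x.
  have rho_le : \sum_(n <- ns) rho n <= 1.
    have r0 : 0 <= \sum_(n <- ns) rho n by apply: sumr_ge0 => n _; exact: ltW.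
    have k1 : 1 <= (k%:R : R) by rewrite ler1n.
    have q1 : 1 <= Num.sqrt 2 :> R by rewrite -[leLHS]sqrtr1 ler_wsqrtr// ler1n.
    have := pen; set r := \sum_(n <- ns) rho n in r0 *; set q := Num.sqrt 2 in q1 *.
    have h1 : r <= q * r by rewrite ler_peMl.
    have h2 : q * r <= k%:R * (q * r) by rewrite ler_peMl// (le_trans r0).
    by move=> h3; have := le_trans h1 (le_trans h2 h3); lra.
  (* [g^2 <= 4 * expR (g^2 / 4)] and the penalty is at most [1/2]. Together with [rho_le] this
     yields the bound [3 = 1 + 2]. *)
  have pen4 : \sum_(j <- J) be j * G c j ^+ 2 <= 2.
    apply: (@le_trans _ _ (4 * pen')); last by lra.
    apply: (@le_trans _ _ (4 * \sum_(j <- J) be j * expR (G c j ^+ 2 / 4))).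
      rewrite mulr_sumr; apply: ler_sum => j _; rewrite [leRHS]mulrCA ler_wpM2l//.
      by have := expR_ge1Dx (G c j ^+ 2 / 4); lra.
    rewrite ler_pM2l// /pen' (bigD1 c)//= lerDl.
    by apply: sumr_ge0 => c' _; apply: sumr_ge0 => j _; rewrite mulr_ge0 ?expR_ge0.
  rewrite sumJ /=.
  apply: (@le_trans _ _ (\sum_(n <- ns) rho n *
      ((1 + (\sum_(i < m n) G c (n, i : nat) ^+ 2) / (m n)%:R) * `|x|))).
    apply: le_trans (ler_norm_sum _ _ _) _; rewrite big_seq [leRHS]big_seq.
    apply: ler_sum => n nns; rewrite (_ : \sum_i _ =
      rho n * \sum_(i < m n) G c (n, i : nat) * psi n i x); last first.
      by rewrite mulr_sumr; apply: eq_bigr => i _; rewrite mulrCA.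
    rewrite normrM gtr0_norm// ler_pM2l//.
    exact: (psile _ nns (fun i => G c (n, i))).
  under eq_bigr do rewrite mulrA mulrDr mulr1; rewrite -mulr_suml ler_wpM2r//.
  rewrite big_split/=; apply: (@le_trans _ _ (1 + 2)); last by lra.
  apply: lerD => //; move: pen4; rewrite sumJ; congr (_ <= _).
  by apply: eq_bigr => n _; rewrite mulr_suml mulr_sumr; apply: eq_bigr => i _; rewrite /be/=; ring.
move=> n z nns zZ.
have nzP : (n, z) \in P by apply/allpairsPdep; exists n, z.
have F0 (p : nat * B) : 0 <= 1 * \prod_(c < k) gbump (S p) (\sum_(j <- J) a p j * G c j).
  by rewrite mul1r prodr_ge0// => c _; exact: expR_ge0.
have := ler_sum_term F0 nzP; rewrite -/bad' mul1r prod_gbump => hP.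
set y := \sum_(c < k) _ in hP.
have -> : \sum_(c < k) (\sum_(j <- J) G c j * (rho j.1 * psi j.1 j.2 z)) ^+ 2 = y.
  by apply: eq_bigr => c _; congr (_ ^+ 2); apply: eq_bigr => j _; rewrite mulrC.
(* With [1 - u <= expR (- u)] this gives [u >= 1/2] for [u = y / (2 * S)], that is
   [y >= S = s n ^+ 2]. *)
have h1 : expR (- (y / (2 * S (n, z)))) <= 2^-1 by apply: (le_trans hP); lra.
have h2 := expR_ge1Dx (- (y / (2 * S (n, z)))).
have h3 : 2^-1 <= y / (2 * S (n, z)) by lra.
move: h3; rewrite ler_pdivlMr ?mulr_gt0// mulrA mulVf// mul1r.
by [].
Qed.

(** * Limits of functionals along an ultrafilter *)

(** Compactness of the segment gives a cluster point, and an ultrafilter converges to each of its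
    cluster points. *)
Lemma ultra_segment_cvg (R : realType) (F : set_system nat) (u : nat -> R)
    (K : R) : UltraFilter F -> (forall n, `|u n| <= K) ->
  exists2 p, `|p| <= K & u n @[n --> F] --> p.
Proof.
move=> FU uK; have FF : ProperFilter F by exact: ultra_proper.
have uF : (u @ F) [set` `[- K, K]].
  by apply: (@filterE _ F) => n; rewrite /= in_itv/= -ler_norml.
have [p [pK clp]] := @segment_compact R (- K) K (u @ F) (fmap_proper_filter _ _) uF.
exists p; first by move: pK; rewrite /= in_itv/= -ler_norml.
move=> A pA; have [//|FcA] := in_ultra_setVsetC (u @^-1` A) FU.
by have [x [/= nAx Ax]] := clp (~` A) A FcA pA.
Qed.

Lemma cvg_sumr (R : realType) (T I : Type) (F : set_system T) {FF : Filter F}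
    (r : seq I) (f : I -> T -> R) (l : I -> R) :
  (forall i, f i x @[x --> F] --> l i) ->
  \sum_(i <- r) f i x @[x --> F] --> \sum_(i <- r) l i.
Proof.
move=> fl; elim: r => [|i r IH].
  by under eq_fun do rewrite big_nil; rewrite big_nil; exact: cvg_cst.
by under eq_fun do rewrite big_cons; rewrite big_cons; exact: cvgD.
Qed.

(** A single ultrafilter finer than [\oo] gives limits at all points [x] at once, which a
    subsequence may fail to do in a large space. *)
Lemma functional_ultralimit (R : realType) (B : normedModType R) (k : nat)
    (L : nat -> 'I_k -> B -> R) (K : R) :
  (forall M c, scalar (L M c)) -> (forall M c x, `|L M c x| <= K * `|x|) ->
  exists l : 'I_k -> B -> R, [/\ forall c, scalar (l c),
    forall c x, `|l c x| <= K * `|x| &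
    forall x a, (\forall M \near \oo, a <= \sum_c L M c x ^+ 2) ->
      a <= \sum_c l c x ^+ 2].
Proof.
move=> Ll LK; have [F [FU ooF]] := ultraFilterLemma (F := \oo) _.
have FF : ProperFilter F by exact: ultra_proper.
have [l ll] := choice (fun cx : 'I_k * B =>
  let: ex_intro2 p p1 p2 := ultra_segment_cvg FU (fun n => LK n cx.1 cx.2) in
  ex_intro (fun p : R => `|p| <= K * `|cx.2| /\ L n cx.1 cx.2 @[n --> F] --> p)
    p (conj p1 p2)).
exists (fun c x => l (c, x)); split.
- move=> c a x y; have [_ l1] := ll (c, a *: x + y).
  have [_ l2] := ll (c, x); have [_ l3] := ll (c, y).
  have l4 : L n c (a *: x + y) @[n --> F] --> a * l (c, x) + l (c, y).
    under eq_fun do rewrite Ll; apply: cvgD => //; exact: cvgMr.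
  exact: (cvg_unique _ l1 l4).
- by move=> c x; have [] := ll (c, x).
- move=> x a /ooF; apply: cvgr_to_ge.
  by apply: cvg_sumr => c; have [_ lc] := ll (c, x); apply: cvgM.
Qed.

(** * Dyadic scales *)

Section Dyadic.
Context {R : realType}.

Definition dyadic (n : nat) : R := 2^-1 ^+ n.

Lemma dyadic_gt0 n : 0 < dyadic n.
Proof. by rewrite exprn_gt0. Qed.

Lemma dyadicS n : dyadic n.+1 = 2^-1 * dyadic n.
Proof. exact: exprS. Qed.

Lemma dyadic_small (e : R) : 0 < e -> exists n0, forall n, (n0 <= n)%N ->
  0 < dyadic n < e.
Proof.
move=> e0; have : dyadic n @[n --> \oo] --> 0.
  by apply: cvg_expr; rewrite ger0_norm//; lra.
move=> /cvgr_lt/(_ _ e0)[n0 _ H]; exists n0 => n n0n.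
by rewrite dyadic_gt0; exact: H.
Qed.

(** A geometric series of ratio [q < 1]: [K = 1 / (1 - q)] solves [1 + q * K = K], so the induction
    closes with [K] independent of [j] and [n]. *)
Lemma dyadic_sum (a : R) : 0 < a ->
  exists2 K, 0 <= K & forall j n, \sum_(i <- iota n j) dyadic i `^ a <= K * dyadic n `^ a.
Proof.
move=> a0; pose q : R := 2^-1 `^ a.
have q0 : 0 <= q by exact: powR_ge0.
have q1 : q < 1.
  have <- : 1 `^ a = 1 :> R by rewrite powR1.
  by rewrite gt0_ltr_powR ?nnegrE//; lra.
have q10 : 0 < 1 - q by rewrite subr_gt0.
exists (1 - q)^-1; first by rewrite invr_ge0 ltW.
elim=> [n|j IH n] /=.
  by rewrite big_nil mulr_ge0 ?invr_ge0 ?powR_ge0// ltW.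
rewrite big_cons; apply: le_trans (lerD (lexx _) (IH _)) _.
rewrite dyadicS powRM ?(ltW (dyadic_gt0 n))// -/q.
by rewrite le_eqVlt; apply/orP; left; apply/eqP; field; rewrite gt_eqF.
Qed.

(** Take the least admissible [n]. If it is [n0], the upper bound is [D] itself; otherwise
    minimality gives [x < 4 * dyadic n], and [4 <= D / dyadic n0]. *)
Lemma dyadic_between (n0 : nat) (x D : R) : 0 < x <= D -> 4 * dyadic n0 <= D ->
  exists2 n, (n0 <= n)%N &
    2 * dyadic n <= x <= D / dyadic n0 * dyadic n.
Proof.
move=> /andP[x0 xD] n0D; have [|N /(_ N (leqnn N))/andP[_ Nx]] := @dyadic_small (x / 2).
  by rewrite divr_gt0.
have exn : exists n, (n0 <= n)%N && (2 * dyadic n <= x).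
  exists (maxn n0 N); rewrite leq_maxl/=.
  have : dyadic (maxn n0 N) <= dyadic N by rewrite ler_wiXn2l ?leq_maxr//; lra.
  by lra.
case: (ex_minnP exn) => n /andP[n0n nx] nmin; exists n => //; rewrite nx/=.
have d0 := dyadic_gt0 n0.
have [->|nn0] := eqVneq n n0; first by rewrite divfK// gt_eqF.
case: n n0n nx nmin nn0 => [|n] n0n nx nmin nn0.
  by move: n0n nn0; rewrite leqn0 => /eqP ->; rewrite eqxx.
have nn : (n0 <= n)%N by rewrite -ltnS ltn_neqAle eq_sym nn0.
have : x < 2 * dyadic n.
  rewrite ltNge; apply/negP => xn; have := nmin n; rewrite nn xn => /(_ isT).
  by rewrite ltnn.
move=> /ltW /le_trans; apply; rewrite dyadicS mulrA ler_wpM2r ?(ltW (dyadic_gt0 n))//.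
by rewrite mulrAC ler_pdivlMr//; lra.
Qed.

End Dyadic.

Arguments dyadic R n : clear implicits.

(** Differences of centres, those shorter than [e] being discarded. The margin [2 * r] ensures that
    the one near [x - y] survives. *)
Lemma difference_net (R : realType) (B : normedModType R) (X : set B)
    (r e : R) (n : nat) : covers X r n ->
  exists Z : seq B, [/\ (size Z <= n ^ 2)%N,
    forall z, z \in Z -> exists x y, [/\ X x, X y, z = x - y & e <= `|z|] &
    forall x y, X x -> X y -> e + 2 * r <= `|x - y| ->
      exists2 z, z \in Z & `|x - y - z| <= 2 * r].
Proof.
move=> [c Xc cov].
exists [seq z <- [seq c p.1 - c p.2 | p : 'I_n * 'I_n] | e <= `|z|]; split.
- rewrite size_filter (leq_trans (count_size _ _))// size_map -cardT.
  by rewrite card_prod card_ord.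
- move=> z; rewrite mem_filter => /andP[ez /mapP[p _ zE]].
  by exists (c p.1), (c p.2).
move=> x y Xx Xy exy; have [i _ ix] := cov _ Xx; have [j _ jy] := cov _ Xy.
move: ix jy; rewrite -!ball_normE /= => ix jy.
have zc : `|x - y - (c i - c j)| <= 2 * r.
  have -> : x - y - (c i - c j) = (c j - y) - (c i - x).
    by rewrite !opprB [x - y]addrC addrACA [- y + c j]addrC.
  by apply: le_trans (ler_normB _ _) _; lra.
exists (c i - c j) => //; rewrite mem_filter; apply/andP; split; last first.
  by apply/mapP; exists (i, j); rewrite ?mem_enum.
have := ler_normD (x - y - (c i - c j)) (c i - c j); rewrite subrK.
by lra.
Qed.

(** One [eta] absorbs the constant of the block bound, the other makes the weights [rho] summable.
    The average of the bumps at scale [n] is at most a constant times [dyadic n] to the power [ga],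
    and [gap] says exactly that [ga > 0]. *)
Lemma dyadic_embedding (R : realType) (B : normedModType R) (X : set B)
    (k : nat) (d t eta theta : R) :
  (0 < k)%N -> 0 <= d -> 0 <= t -> 0 < eta -> 0 < theta ->
  theta * k%:R * ((1 + d) * (1 + t / 2) + eta + eta) + 2 * d < k%:R ->
  (\forall e \near 0^'+, exists2 n, covers X e n & n%:R <= e `^ (- d)) ->
  (\forall e \near 0^'+, exists2 n, approximations X e n & n%:R <= e `^ (- t)) ->
  exists (l : 'I_k -> B -> R) (n0 : nat), [/\ forall c, scalar (l c),
    forall c x, `|l c x| <= 3 * `|x| &
    forall n x y, (n0 <= n)%N -> X x -> X y -> 2 * dyadic R n <= `|x - y| ->
      (dyadic R n `^ theta^-1) ^+ 2 <= 4 * \sum_c l c (x - y) ^+ 2].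
Proof.
move=> k0 d0 t0 eta0 th0 gap Xcov Xapp.
have kR0 : 0 < k%:R :> R by rewrite ltr0n.
have kR1 : 1 <= k%:R :> R by rewrite ler1n.
set si := (1 + d) * (1 + t / 2) + eta in gap *.
have dt1 : 1 <= (1 + d) * (1 + t / 2) by nra.
(* This gives [s n <= dyadic n], so that the nets are finer than their scale. *)
have th1 : theta <= 1.
  rewrite leNgt; apply/negP => th1.
  have h1 : k%:R < theta * k%:R by rewrite ltr_pMl.
  have h2 : theta * k%:R <= theta * k%:R * (si + eta).
    by rewrite ler_peMr ?(ltW (lt_trans kR0 h1))// /si; lra.
  by lra.
have dtsi : (1 + d) * (1 + t / 2) < si by rewrite ltrDl.
have [e1 e10 blk] := block_functionals d0 t0 dtsi Xcov Xapp.
have [e2 e20 cov] := near0_threshold Xcov.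
pose ga := (k%:R - 2 * d) / theta - k%:R * (si + eta).
have ga0 : 0 < ga.
  rewrite subr_gt0 ltr_pdivlMr//; move: gap; set u := si + eta; lra.
have [K1 K10 sum1] := @dyadic_sum R _ eta0.
have [K2 K20 sum2] := @dyadic_sum R _ ga0.
have [e3 e30 small1] := @powR_small _ (4 * (k%:R * (Num.sqrt 2 * K1))) _ eta0.
(* [small1] and [small2] start the scales late enough for the penalty and the bumps to stay within
   [1/4] each, however many scales follow. *)
have [e4 e40 small2] := @powR_small _ (4 * ((12 * k%:R) `^ (2 * d) * K2)) _ ga0.
have [|n0 n0P] := @dyadic_small R (Num.min 1 (Num.min e1 (Num.min e2 (Num.min e3 e4)))).
  by rewrite !lt_min ltr01 e10 e20 e30.
have {n0P} n0P n : (n0 <= n)%N ->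
    [/\ 0 < dyadic R n < e1, 0 < dyadic R n < e3, 0 < dyadic R n < e4,
        dyadic R n < e2 & dyadic R n <= 1].
  move=> /n0P; rewrite !lt_min => /andP[h /and5P[/ltW h1 h2 h3 h4 h5]].
  by split; rewrite ?h ?h1 ?h2 ?h3 ?h4 ?h5.
pose s n : R := dyadic R n `^ theta^-1.
(* A coordinate changes by at most [3 * (2 * r n) = s n / (2k)] from [x - y] to its net point, so
   the total quadratic error [k * 2 * (6 * r n)^2] is at most [s n ^+ 2 / 2]. *)
pose r n : R := s n / (12 * k%:R).
pose rho n : R := dyadic R n `^ eta.
pose tt n : R := dyadic R n `^ si.
have s0 n : 0 < s n by rewrite powR_gt0 ?dyadic_gt0.
have r0 n : 0 < r n by rewrite divr_gt0 ?mulr_gt0.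
have sle n : (n0 <= n)%N -> s n <= dyadic R n.
  move=> /n0P[_ _ _ _ n1]; rewrite -[leRHS]powRr1 ?(ltW (dyadic_gt0 n))//.
  by apply: ger_powR; rewrite ?dyadic_gt0// invf_ge1.
have rle n : (n0 <= n)%N -> r n <= dyadic R n / 12.
  move=> /sle sn; rewrite ler_pdivrMr ?mulr_gt0//.
  by have := dyadic_gt0 (R := R) n; nra.
have /choice[p pP] : forall n, exists p : nat * (nat -> B -> R),
    (forall i, scalar (p.2 i)) /\ ((n0 <= n)%N ->
    (forall (g : nat -> R) x, `|\sum_(i < p.1) g i * p.2 i x| <=
      (1 + (\sum_(i < p.1) g i ^+ 2) / p.1%:R) * `|x|) /\
    forall x y, X x -> X y -> dyadic R n <= `|x - y| ->
      tt n ^+ 2 <= \sum_(i < p.1) p.2 i (x - y) ^+ 2).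
  move=> n.
  have [/n0P[ne1 _ _ _ _]|nn0] := leqP n0 n.
    by have [m [psi [h1 h2 h3]]] := blk _ ne1; exists (m, psi); split.
  exists (0%N, fun=> fun=> 0); split=> //= i a x y.
  by rewrite mulr0 addr0.
have /choice[Z ZP] : forall n, exists Z : seq B, (n0 <= n)%N ->
    [/\ (size Z)%:R <= (12 * k%:R) `^ (2 * d) * dyadic R n `^ (- (2 * d / theta)),
    forall z, z \in Z -> tt n ^+ 2 <= \sum_(i < (p n).1) (p n).2 i z ^+ 2 &
    forall x y, X x -> X y -> 2 * dyadic R n <= `|x - y| ->
      exists2 z, z \in Z & `|x - y - z| <= 2 * r n].
  move=> n.
  have [n0n|nn0] := leqP n0 n; last by exists [::].
  have [_ _ _ ne2 _] := n0P _ n0n; have rn := rle _ n0n.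
  have dn0 := dyadic_gt0 (R := R) n.
  have re2 : 0 < r n < e2 by rewrite r0/=; lra.
  have [N covN Nd] := cov _ re2.
  have [Zn [Zs Zt Znet]] := difference_net (dyadic R n) covN.
  exists Zn => _; split.
  - apply: (@le_trans _ _ (N%:R ^+ 2)); first by rewrite -natrX ler_nat.
    apply: (@le_trans _ _ ((r n `^ (- d)) ^+ 2)).
      by rewrite ler_pXn2r// nnegrE ?powR_ge0.
    rewrite -powR_mulrn ?powR_ge0// -powRrM /r /s powRM ?powR_ge0//.
    rewrite powR_invr ?mulr_ge0// -powRrM mulrC.
    rewrite (_ : - (- d * 2) = 2 * d); last by ring.
    by rewrite (_ : theta^-1 * (- d * 2) = - (2 * d / theta)); last by ring.
  - move=> z /Zt[x [y [Xx Xy -> zn]]].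
    by have [_ /(_ n0n)[_]] := pP n; apply.
  - by move=> x y Xx Xy xyn; apply: Znet => //; lra.
have /choice[L LP] : forall M, exists L : 'I_k -> B -> R,
    [/\ forall c, scalar (L c), forall c x, `|L c x| <= 3 * `|x| &
    forall n z, n \in iota n0 M -> z \in Z n -> s n ^+ 2 <= \sum_c L c z ^+ 2].
  move=> M.
  have iota0 n : n \in iota n0 M -> (n0 <= n)%N by rewrite mem_iota => /andP[].
  have [_ n0e3 n0e4 _ _] := n0P _ (leqnn n0).
  apply: (@finite_stage _ _ k (iota n0 M) (fun n => (p n).1) (fun n => (p n).2) rho s tt Z) => //.
  - exact: iota_uniq.
  - by move=> n i; have [] := pP n.
  - by move=> n /iota0 n0n; have [_ /(_ n0n)[]] := pP n.
  - by move=> n; rewrite powR_gt0 ?dyadic_gt0.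
  - by move=> n; rewrite powR_gt0 ?dyadic_gt0.
  - by move=> n z /iota0/ZP[_ + _]; apply.
  - have h1 := sum1 M n0; have h2 := small1 _ n0e3.
    apply: (@le_trans _ _ (k%:R * (Num.sqrt 2 * (K1 * dyadic R n0 `^ eta)))).
      by rewrite ler_pM2l// ler_wpM2l.
    by rewrite !mulrA; move: h2; rewrite !mulrA; lra.
  - have h1 := sum2 M n0; have h2 := small2 _ n0e4.
    apply: (@le_trans _ _ ((12 * k%:R) `^ (2 * d) * (K2 * dyadic R n0 `^ ga))); last first.
      by rewrite !mulrA; move: h2; rewrite !mulrA; lra.
    apply: (@le_trans _ _ ((12 * k%:R) `^ (2 * d) * \sum_(i <- iota n0 M) dyadic R i `^ ga)).
      rewrite mulr_sumr big_seq [leRHS]big_seq; apply: ler_sum => n /iota0 n0n.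
      have [Zs _ _] := ZP _ n0n; have dn0 := dyadic_gt0 (R := R) n.
      apply: (@le_trans _ _ ((12 * k%:R) `^ (2 * d) * dyadic R n `^ (- (2 * d / theta))
          * (s n / (rho n * tt n)) ^+ k)).
        by rewrite ler_wpM2r// exprn_ge0// divr_ge0 ?mulr_ge0 ?powR_ge0.
      rewrite -mulrA ler_wpM2l ?powR_ge0//.
      have dD (a b : R) : dyadic R n `^ (a + b) = dyadic R n `^ a * dyadic R n `^ b.
        by rewrite powRD// (lt0r_neq0 dn0) implybT.
      have -> : s n / (rho n * tt n) = dyadic R n `^ (theta^-1 - (eta + si)).
        by rewrite dD powRN dD.
      rewrite -powR_mulrn ?powR_ge0// -powRrM -dD le_eqVlt; apply/orP; left.
      by apply/eqP; congr powR; rewrite /ga; field; rewrite gt_eqF.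
    by rewrite ler_wpM2l ?powR_ge0.
have [l [ll l3 lge]] := @functional_ultralimit _ _ _ L 3
  (fun M => let: And3 h _ _ := LP M in h) (fun M => let: And3 _ h _ := LP M in h).
exists l, n0; split=> // n x y n0n Xx Xy xyn.
have [_ _ /(_ _ _ Xx Xy xyn)[z zZ zr]] := ZP _ n0n.
have sz : s n ^+ 2 <= \sum_c l c z ^+ 2.
  (* Stage [M] treats the scales from [n0] to [n0 + M - 1], so every later stage includes scale
     [n]. *)
  apply: lge; exists (n - n0).+1 => // M /= nM.
  have [_ _] := LP M; apply => //; rewrite mem_iota n0n/=.
  by rewrite -ltn_subLR.
have lB c (u v : B) : l c (u - v) = l c u - l c v.
  by rewrite -[- v]scaleN1r addrC ll mulN1r addrC.
have lzle c : l c z ^+ 2 <= 2 * l c (x - y) ^+ 2 + 2 * (6 * r n) ^+ 2.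
  have h1 : `|l c (x - y) - l c z| <= 6 * r n.
    rewrite -lB; apply: le_trans (l3 _ _) _; lra.
  have h2 : (l c (x - y) - l c z) ^+ 2 <= (6 * r n) ^+ 2.
    by rewrite -real_normK ?num_real// ler_pXn2r// nnegrE mulr_ge0// ltW.
  by have := sqr_ge0 (2 * l c (x - y) - l c z); move: h2; rewrite !expr2; lra.
have hsum : \sum_c l c z ^+ 2 <= 2 * (\sum_c l c (x - y) ^+ 2) + k%:R * (2 * (6 * r n) ^+ 2).
  apply: (@le_trans _ _ (\sum_(c < k) (2 * l c (x - y) ^+ 2 + 2 * (6 * r n) ^+ 2))).
    by apply: ler_sum => c _.
  by rewrite big_split/= -mulr_sumr sumr_const card_ord [X in _ <= _ + X]mulr_natl.
have rs : k%:R * (2 * (6 * r n) ^+ 2) <= s n ^+ 2 / 2.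
  have -> : k%:R * (2 * (6 * r n) ^+ 2) = s n ^+ 2 / (2 * k%:R).
    by rewrite /r; field; rewrite gt_eqF.
  rewrite ler_pM2l ?exprn_gt0// lef_pV2 ?posrE ?mulr_gt0//.
  by lra.
by rewrite -/(s n); lra.
Qed.

(** * Choice of exponents and conclusion *)

Lemma exponent_slack (R : realFieldType) (d t k theta : R) :
  0 <= d -> 0 <= t -> 0 < k ->
  0 < theta < (k - 2 * d) / (k * (1 + d) * (1 + t / 2)) ->
  exists2 eta, 0 < eta &
    theta * k * ((1 + (d + eta)) * (1 + (t + eta) / 2) + eta + eta)
      + 2 * (d + eta) < k.
Proof.
move=> d0 t0 k0 /andP[th0].
have D0 : 0 < k * (1 + d) * (1 + t / 2).
  by rewrite !mulr_gt0//; [rewrite ltr_wpDr|rewrite ltr_wpDr// divr_ge0].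
rewrite ltr_pdivlMr// => gap.
have tk0 : 0 < theta * k by rewrite mulr_gt0.
pose g := k - 2 * d - theta * (k * (1 + d) * (1 + t / 2)).
have g0 : 0 < g by rewrite subr_gt0.
(* The linear coefficient in [eta] has [7/2] in place of [4]; the extra half dominates the term
   [eta^2 / 2], since [eta <= 1]. *)
pose C := theta * k * (4 + (d + t) / 2) + 2.
have C0 : 0 < C.
  by rewrite addr_gt0// mulr_gt0// ltr_wpDr// divr_ge0// addr_ge0.
pose eta := Num.min 1 (g / (2 * C)).
have eta0 : 0 < eta by rewrite lt_min ltr01 divr_gt0// mulr_gt0.
have eta1 : eta <= 1 by rewrite ge_min lexx.
have etag : eta * C < g.
  have : eta <= g / (2 * C) by rewrite ge_min lexx orbT.
  by rewrite ler_pdivlMr ?mulr_gt0//; lra.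
exists eta => //.
have -> : theta * k * ((1 + (d + eta)) * (1 + (t + eta) / 2) + eta + eta)
      + 2 * (d + eta) = k - g + eta * C - theta * k * (eta * (1 - eta) / 2).
  by rewrite /g /C; field.
have : 0 <= theta * k * (eta * (1 - eta) / 2).
  by rewrite !mulr_ge0 ?invr_ge0 ?(ltW th0) ?(ltW k0) ?(ltW eta0) ?subr_ge0.
by lra.
Qed.

Lemma row_norm_le (R : realType) (k : nat) (v : 'rV[R]_k) (K : R) : 0 <= K ->
  (forall c, `|v ord0 c| <= K) -> `|v| <= K.
Proof.
move=> K0 vK; have -> : `|v| = mx_norm v by [].
have [->//|/mx_norm_neq0[[i c] /= ->]] := eqVneq (mx_norm v) 0.
by rewrite (ord1 i).
Qed.

Lemma row_functional (R : realType) (B : normedModType R) (k : nat)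
    (l : 'I_k -> B -> R) (K : R) : 0 <= K ->
  (forall c, scalar (l c)) -> (forall c x, `|l c x| <= K * `|x|) ->
  exists2 L : {linear B -> 'rV[R]_k}, continuous L &
    forall x, L x = \row_c l c x.
Proof.
move=> K0 ll lK; pose f x : 'rV[R]_k := \row_c l c x.
have flin : linear f.
  by move=> a x y; apply/rowP => c; rewrite !mxE ll.
pose L := HB.pack_for {linear B -> 'rV[R]_k} f
  (GRing.isLinear.Build R B 'rV[R]_k *:%R f flin).
exists L => //; apply: bounded_linear_continuous; apply/linear_boundedP.
near=> r => x; apply: row_norm_le; first by rewrite mulr_ge0.
move=> c; rewrite mxE; apply: le_trans (lK c x) _; rewrite ler_wpM2r//.
Unshelve. all: by end_near. Qed.

(* The hypothesis on k forces box_dim X < +oo, and for compact X one has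
   thickness_exponent X <= box_dim X.  So [fine] only affects the value -oo
   (X empty or X = {0}), which it replaces by 0. *)
Theorem theorem2p4 (R : realType) (B : completeNormedModType R) (X : set B)
    (k : nat) (theta : R) :
  compact X ->
  (2%:E * box_dim X < (k%:R)%:E)%E ->
  let d := fine (box_dim X) in
  let tau := fine (thickness_exponent X) in
  0 < theta < (k%:R - 2 * d) / (k%:R * (1 + d) * (1 + tau / 2)) ->
  exists L : {linear B -> 'rV[R]_k}, exists C : R,
    [/\ continuous L,
        0 < C,
        forall x y, X x -> X y -> `|x - y| <= C * eucl_norm (L x - L y) `^ theta,
        set_bij X (L @` X) L &
        exists2 g : 'rV[R]_k -> B,
          (forall x, X x -> g (L x) = x) & holder_on theta (L @` X) g].
Proof.
move=> cX dk d tau dtheta; have /andP[th0 _] := dtheta.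
(* For [k = 0] the bound on [theta] is a division by zero, hence 0, and contradicts [0 < theta]. *)
have k0 : (0 < k)%N.
  rewrite lt0n; apply/eqP => k0; move: dtheta.
  by rewrite k0 !mul0r invr0 mulr0 => /andP[/lt_trans/[apply]]; rewrite ltxx.
have kR0 : 0 < k%:R :> R by rewrite ltr0n.
have doo : (box_dim X < +oo)%E.
  by rewrite ltey; apply: contraTN dk => /eqP ->; rewrite gt0_muley ?lte_fin// -leNgt leey.
have too := thickness_lty doo.
have d0 : 0 <= d by exact: growth_fine_ge0.
have t0 : 0 <= tau by exact: growth_fine_ge0.
have [eta eta0 gap] := exponent_slack d0 t0 kR0 dtheta.
have [l [n0 [ll l3 lge]]] := @dyadic_embedding R B X k (d + eta) (tau + eta) eta theta
  k0 (addr_ge0 d0 (ltW eta0)) (addr_ge0 t0 (ltW eta0)) eta0 th0 gap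
  (growth_fine_lt (s := d + eta) doo ltac:(by rewrite ltrDl))
  (growth_fine_lt (s := tau + eta) too ltac:(by rewrite ltrDl)).
have [L Lc LE] := row_functional (ler0n R 3) ll l3.
have [M M0 XM] := pinfty_ex_gt0 (compact_bounded cX).
(* The first term bounds the distances within [X]; the second provides the size that
   [dyadic_between] asks for. *)
pose D := 2 * M + 4 * dyadic R n0.
have dn0 := @dyadic_gt0 R n0.
pose C := D / dyadic R n0 * 2 `^ theta.
have C0 : 0 < C by rewrite mulr_gt0 ?powR_gt0// divr_gt0//; rewrite /D; lra.
have LC x y : X x -> X y -> `|x - y| <= C * eucl_norm (L x - L y) `^ theta.
  move=> Xx Xy; have [->|xy] := eqVneq x y.
    by rewrite subrr normr0 mulr_ge0 ?powR_ge0// ltW.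
  have xyD : 0 < `|x - y| <= D.
    rewrite normr_gt0 subr_eq0 xy/=; apply: le_trans (ler_normB _ _) _.
    by have := XM _ Xx; have := XM _ Xy; rewrite /D /=; lra.
  have [|n n0n /andP[nxy xyn]] := dyadic_between xyD (n0 := n0).
    by rewrite /D; lra.
  have := lge _ _ _ n0n Xx Xy nxy; set s := dyadic R n `^ theta^-1.
  have -> : \sum_c l c (x - y) ^+ 2 = eucl_norm (L x - L y) ^+ 2.
    rewrite /eucl_norm sqr_sqrtr; last by apply: sumr_ge0 => c _; exact: sqr_ge0.
    by apply: eq_bigr => c _; rewrite -linearB LE mxE.
  set E := eucl_norm _ => sE.
  have E0 : 0 <= E by exact: sqrtr_ge0.
  have {}sE : s <= 2 * E.
    rewrite -(@ler_pXn2r _ 2) ?nnegrE ?powR_ge0 ?mulr_ge0// exprMn.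
    by lra.
  apply: (le_trans xyn); rewrite /C -[leRHS]mulrA ler_wpM2l//.
    by rewrite divr_ge0 ?ltW//; rewrite /D; lra.
  rewrite -powRM// (_ : dyadic R n = s `^ theta).
    by apply: ge0_ler_powR; rewrite ?nnegrE ?powR_ge0 ?mulr_ge0// ltW.
  by rewrite /s -powRrM mulVf ?gt_eqF// powRr1// ltW// dyadic_gt0.
have Linj x y : X x -> X y -> L x = L y -> x = y.
  move=> Xx Xy Lxy; have := LC _ _ Xx Xy.
  have -> : eucl_norm (L x - L y) = 0.
    by rewrite Lxy subrr /eucl_norm big1 ?sqrtr0// => c _; rewrite mxE expr0n.
  by rewrite powR0 ?gt_eqF// mulr0 normr_le0 subr_eq0 => /eqP.
have /choice[g gP] : forall u, exists x, (L @` X) u -> X x /\ L x = u.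
  move=> u; have [[x Xx <-]|nu] := pselect ((L @` X) u); first by exists x.
  by exists 0.
have gL x : X x -> g (L x) = x.
  move=> Xx; have [|Xg Lg] := gP (L x); first by exists x.
  exact: Linj.
exists L, C; split=> //.
  by apply: inj_bij => x y; rewrite !inE; exact: Linj.
exists g => //; exists C => _ _ [x Xx <-] [y Xy <-].
by rewrite !gL//; exact: LC.
Qed.
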